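(* Let $n\ge 1$ and let $w \in W^c(\tilde A_n)$ with affine length $L(w)\ge 1$. Then $w$ can be written in a unique way as a reduced word of the following form, for nonnegative integers $p$ and $k$ and for $j\in\{1,\dots,n\}$ (where $j$ plays no role if $k=0$): $$\text{if } p=0:\quad w = (h(j,j+1)\,a_{n+1})^k\, w_r \quad(\text{with } k>0),$$ $$\text{if } p>0:\quad w = h(i_1,r_1)\,a_{n+1}\cdots h(i_p,r_p)\,a_{n+1}\,(h(j,j+1)\,a_{n+1})^k\, w_r,$$ with $w_r\in W^c(A_n)$ and, if $p>0$: (a) $0\le i_1<\dots<i_p<r_p<\dots<r_1\le n+1$ and $r_p-i_p\ge 2$; (b) if $k>0$: either $i_p<j<j+1<r_p$, or $j+1=r_p$. In particular $p\le \left[\frac{n+1}{2}\right]$ (integer part). The element $w_r$ is described as follows. (c) If $k>0$: for some $z\in\{0,\dots,n\}$ such that $j+z-1\le n$, we have: if $z=0$, $w_r=1$; if $z\ge 1$, $w_r=\lfloor j,d_1\rfloor\lfloor j+1,d_2\rfloor\cdots\lfloor j+z-1,d_z\rfloor$ with $1\le d_1<\dots<d_z\le n$ and $j+c\ge d_{c+1}$ for $0\le c\le z-1$. (d) If $k=0$ (hence $p>0$): for some $t\in\{0,\dots,n\}$ we have: if $t=0$, $w_r=1$; if $t\ge 1$, $w_r=\lfloor l_1,g_1\rfloor\lfloor l_2,g_2\rfloor\cdots\lfloor l_t,g_t\rfloor$ with $1\le l_1<\dots<l_t\le n$; $1\le g_1<\dots<g_t\le n$; $l_i\ge g_i$ for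 $1\le i\le t$; $i_p<l_1<r_p$; and for any $i$ with $2\le i\le t$ such that $l_i>l_{i-1}+1$ we have $l_i<r_p$. Conversely, let $j\in\{1,\dots,n\}$. Any word $(h(j,j+1)\,a_{n+1})^k\, w_r$ with $k>0$ and $w_r$ of the form described in (c), and any word $h(i_1,r_1)\,a_{n+1}\cdots h(i_p,r_p)\,a_{n+1}\,(h(j,j+1)\,a_{n+1})^k\, w_r$ with $p>0$, $k\ge 0$, satisfying (a) and (b) and with $w_r$ of the form described in (c) if $k>0$, respectively in (d) if $k=0$, is reduced and fully commutative (i.e. it is a reduced expression of a fully commutative element).
   Context: For $n\ge 1$, $W(\tilde A_n)$ is the affine Coxeter group with the $n+1$ Coxeter generators $\sigma_1,\dots,\sigma_n,a_{n+1}$ whose Dynkin diagram is the cycle $\sigma_1-\sigma_2-\cdots-\sigma_n-a_{n+1}-\sigma_1$: for $n\ge2$, generators adjacent in the cycle have product of order 3 and non-adjacent ones commute; for $n=1$ it is the infinite dihedral group with generators $\sigma_1,a_2$. $W(A_n)$ is the parabolic subgroup generated by $\sigma_1,\dots,\sigma_n$. An element of a Coxeter group is fully commutative if any reduced expression of it can be transformed into any other one using only commutation relations between commuting generators; $W^c(\tilde A_n)$ and $W^c(A_n)$ denote the sets of fully commutative elements. For $u\in W^c(\tilde A_n)$ the affine length $L(u)$ is the number of occurrences of $a_{n+1}$ in a (equivalently, any) reduced expression of $u$. Notation: $\lfloor i,j\rfloor=\sigma_i\sigma_{i-1}\cdots\sigma_j$ for $n\ge i\ge j\ge1$, and $\lfloor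 0,1\rfloor=1$; $\lceil i,j\rceil=\sigma_i\sigma_{i+1}\cdots\sigma_j$ for $1\le i\le j\le n$, and $\lceil n+1,n\rceil=1$; $h(i,r)=\lfloor i,1\rfloor\lceil r,n\rceil$ for $0\le i<r\le n+1$, $(i,r)\ne(0,1)$. All of these are regarded as words in the generators. *)

(* Defs.v *)
From Stdlib Require Import Relation_Operators Operators_Properties.
From HB Require Import structures.
From mathcomp Require Import all_boot.
From mathcomp Require Import boolp classical_sets.

Set Implicit Arguments.
Unset Strict Implicit.
Unset Printing Implicit Defensive.

(* A Coxeter matrix on T; the entry 0 stands for infinity. *)
Record coxeter_matrix (T : choiceType) := CoxeterMatrix {
  cox_entry :> T -> T -> nat;
  cox_diag : forall s, cox_entry s s = 1;
  cox_sym : forall s t, cox_entry s t = cox_entry t s;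
  cox_offdiag : forall s t, s != t -> cox_entry s t != 1
}.

Section CoxeterGroup.
Variables (T : choiceType) (m : coxeter_matrix T).
Implicit Types (s t : T) (u v : seq T) (I : pred T).

(* Insertion or deletion of the relator (s t)^(m s t). For s = t it is s^2,
   and for m s t = 0, that is infinity, it is empty: no relation is imposed.
   As the generators are involutions, positive words suffice. *)
Inductive cox_step : seq T -> seq T -> Prop :=
  CoxStep u v s t :
    cox_step (u ++ flatten (nseq (m s t) [:: s; t]) ++ v) (u ++ v).

Definition cox_eq := clos_refl_sym_trans (seq T) cox_step.
Definition cox_eqb : rel (seq T) := fun u v => `[< cox_eq u v >].

Lemma cox_eqb_refl : reflexive cox_eqb.
Proof. by move=> u; apply/asboolP; apply: rst_refl. Qed.

Lemma cox_eqb_sym : symmetric cox_eqb.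
Proof. by move=> u v; apply/asboolP/asboolP; apply: rst_sym. Qed.

Lemma cox_eqb_trans : transitive cox_eqb.
Proof.
by move=> v u w /asboolP uv /asboolP vw; apply/asboolP; apply: rst_trans vw.
Qed.

Canonical cox_equiv := EquivRel cox_eqb cox_eqb_refl cox_eqb_sym cox_eqb_trans.

Definition coxeter_group := {eq_quot cox_equiv}%qT.
HB.instance Definition _ := Choice.on coxeter_group.

Definition cprod (v : seq T) : coxeter_group := (\pi_coxeter_group v)%qT.

Lemma cprodP u v : cprod u = cprod v <-> cox_eq u v.
Proof.
split=> [/eqmodP /asboolP //|uv]; by apply/eqmodP; apply/asboolP.
Qed.

Lemma cprod_repr (w : coxeter_group) : cprod (repr w) = w.
Proof. exact: reprK. Qed.

Lemma cox_eq_cat u u' v v' :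
  cox_eq u u' -> cox_eq v v' -> cox_eq (u ++ v) (u' ++ v').
Proof.
move=> uu' vv'; apply: (@rst_trans _ _ _ (u' ++ v)).
  elim: uu' => {u u'} [_ _ [x y s t]|u|x y _ IH|x y z _ IH1 _ IH2].
  - by rewrite -!catA; apply: rst_step; apply: CoxStep.
  - exact: rst_refl.
  - exact: rst_sym.
  - exact: rst_trans IH2.
elim: vv' => {v v'} [_ _ [x y s t]|v|x y _ IH|x y z _ IH1 _ IH2].
- by rewrite !(catA u'); apply: rst_step; apply: CoxStep.
- exact: rst_refl.
- exact: rst_sym.
- exact: rst_trans IH2.
Qed.

Lemma cox_eq_square s : cox_eq [:: s; s] [::].
Proof. by apply: rst_step; move: (CoxStep [::] [::] s s); rewrite cox_diag. Qed.

Lemma cox_eq_catrev u : cox_eq (u ++ rev u) [::].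
Proof.
elim: u => [|s u IH]; first exact: rst_refl.
rewrite rev_cons -cats1 -cat1s -catA (catA u).
apply: rst_trans (cox_eq_square s).
apply: (@cox_eq_cat [:: s] [:: s]); first exact: rst_refl.
by apply: (@cox_eq_cat _ [::] [:: s] [:: s]) => //; exact: rst_refl.
Qed.

Lemma cox_eq_rev u v : cox_eq u v -> cox_eq (rev u) (rev v).
Proof.
move=> uv; apply: (@rst_trans _ _ _ (rev u ++ (v ++ rev v))).
  rewrite -{1}(cats0 (rev u)); apply: cox_eq_cat; first exact: rst_refl.
  by apply: rst_sym; apply: cox_eq_catrev.
apply: (@rst_trans _ _ _ (rev u ++ (u ++ rev v))).
  apply: cox_eq_cat; first exact: rst_refl.
  by apply: cox_eq_cat; [exact: rst_sym | exact: rst_refl].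
rewrite catA -{2}(cat0s (rev v)); apply: cox_eq_cat; last exact: rst_refl.
by rewrite -{2}(revK u); apply: cox_eq_catrev.
Qed.

Definition cmul (w w' : coxeter_group) := cprod (repr w ++ generic_quotient.repr w').
Definition cone := cprod [::].
Definition cinv (w : coxeter_group) := cprod (rev (repr w)).

Lemma cmulE u v : cmul (cprod u) (cprod v) = cprod (u ++ v).
Proof. by apply/cprodP; apply: cox_eq_cat; apply/cprodP; apply: cprod_repr. Qed.

Lemma cinvE u : cinv (cprod u) = cprod (rev u).
Proof. by apply/cprodP; apply: cox_eq_rev; apply/cprodP; apply: cprod_repr. Qed.

Lemma cmulA : associative cmul.
Proof.
by move=> x y z; rewrite -[x]cprod_repr -[y]cprod_repr -[z]cprod_repr !cmulE catA.
Qed.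

Lemma cmul1 : left_id cone cmul.
Proof. by move=> x; rewrite -[x]cprod_repr cmulE. Qed.

Lemma c1mul : right_id cone cmul.
Proof. by move=> x; rewrite -[x]cprod_repr cmulE cats0. Qed.

Lemma cmulV : right_inverse cone cinv cmul.
Proof.
by move=> x; rewrite -[x]cprod_repr cinvE cmulE; apply/cprodP/cox_eq_catrev.
Qed.

Lemma cVmul : left_inverse cone cinv cmul.
Proof.
move=> x; rewrite -[x]cprod_repr cinvE cmulE; apply/cprodP.
by rewrite -{2}(revK (repr x)); apply: cox_eq_catrev.
Qed.

HB.instance Definition _ :=
  isGroup.Build coxeter_group cmulA cmul1 c1mul cVmul cmulV.

Lemma cprod_bigE v : cprod v = (\prod_(s <- v) cprod [:: s])%g.
Proof.
elim: v => [|s v IH]; first by rewrite big_nil.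
by rewrite big_cons -IH -cat1s; symmetry; apply: cmulE.
Qed.

(* The notions below are relative to the parabolic subgroup generated by I,
   itself a Coxeter group with set of generators I. *)
Definition expr_in I (w : coxeter_group) v := all I v /\ cprod v = w.

Definition parabolic I (w : coxeter_group) := exists v, expr_in I w v.

Definition reduced_in I (w : coxeter_group) v :=
  expr_in I w v /\ forall v', expr_in I w v' -> size v <= size v'.

Inductive comm_step : seq T -> seq T -> Prop :=
  CommStep u v s t :
    m s t = 2 -> comm_step (u ++ [:: s; t] ++ v) (u ++ [:: t; s] ++ v).

Definition comm_eq := clos_refl_sym_trans (seq T) comm_step.

Definition fc_in I (w : coxeter_group) :=
  parabolic I w /\
  forall v v', reduced_in I w v -> reduced_in I w v' -> comm_eq v v'.

Definition reduced_expr := reduced_in predT.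
Definition reduced_word v := reduced_expr (cprod v) v.
Definition fully_commutative := fc_in predT.

Lemma reduced_exprE w v : reduced_expr w v <->
  cprod v = w /\ forall v', cprod v' = w -> size v <= size v'.
Proof.
rewrite /reduced_expr /reduced_in /expr_in all_predT.
split=> [[[_ ->] h]|[-> h]]; split=> // v'.
  by move=> v'w; apply: h; rewrite all_predT.
by case=> _; apply: h.
Qed.

Lemma fully_commutativeE w : fully_commutative w <->
  forall v v', reduced_expr w v -> reduced_expr w v' -> comm_eq v v'.
Proof.
split=> [[]//|h]; split=> //.
by exists (repr w); split; [rewrite all_predT | apply: cprod_repr].
Qed.

Lemma reduced_expr_exists w : exists v, reduced_expr w v.
Proof.
have h : exists k, `[< exists2 v, cprod v = w & size v = k >].
  exists (size (repr w)); apply/asboolP.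
  by exists (repr w) => //; apply: cprod_repr.
case: (ex_minnP h) => k /asboolP [v vw <-] kmin.
exists v; apply/reduced_exprE; split=> // v' v'w.
by apply: kmin; apply/asboolP; exists v'.
Qed.

Definition occurrences s (w : coxeter_group) : nat :=
  count_mem s (xget [::] [set v | reduced_expr w v]%classic).

Lemma comm_eq_perm u v : comm_eq u v -> perm_eq u v.
Proof.
elim=> {u v} [_ _ [u v s t _]|//|u v _|u v z _ IH1 _ IH2].
- by rewrite perm_cat2l perm_cat2r (perm_catC [:: s] [:: t]).
- by rewrite perm_sym.
- exact: perm_trans IH2.
Qed.

Lemma occurrencesE s w v :
  fully_commutative w -> reduced_expr w v -> occurrences s w = count_mem s v.
Proof.
move=> /fully_commutativeE fcw redv; rewrite /occurrences.
by case: xgetP => [x _ redx|/(_ v)//]; apply/permP/comm_eq_perm/fcw.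
Qed.

End CoxeterGroup.

Section AffineA.
Variable n : nat.

(* The n + 1 generators are indexed along the cycle by Z/(n+1): the index 0 is
   a_{n+1} and the index i, for 1 <= i <= n, is sigma_i. *)
Definition gen := 'I_n.+1.
Definition aff : gen := ord0.
Definition sigma (i : nat) : gen := inord i.

Definition adjacent (s t : gen) :=
  (s.+1 == t %[mod n.+1]) || (t.+1 == s %[mod n.+1]).

Definition affA_entry (s t : gen) : nat :=
  if s == t then 1
  else if n == 1 then 0
  else if adjacent s t then 3 else 2.

Lemma affA_diag s : affA_entry s s = 1.
Proof. by rewrite /affA_entry eqxx. Qed.

Lemma affA_sym s t : affA_entry s t = affA_entry t s.
Proof. by rewrite /affA_entry /adjacent eq_sym orbC. Qed.

Lemma affA_offdiag s t : s != t -> affA_entry s t != 1.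
Proof.
by rewrite /affA_entry => /negPf ->; case: ifP => // _; case: ifP.
Qed.

Definition affA : coxeter_matrix gen :=
  CoxeterMatrix affA_diag affA_sym affA_offdiag.

Definition is_sigma : pred gen := fun s => s != aff.

(* W^c(A_n), inside the parabolic subgroup generated by the sigma_i. *)
Definition WcA : coxeter_group affA -> Prop := fc_in is_sigma.

Definition affine_length : coxeter_group affA -> nat := occurrences aff.

(* sigma_i sigma_{i-1} ... sigma_j, empty for (i, j) = (0, 1). *)
Definition wfloor (i j : nat) : seq gen := map sigma (rev (iota j (i.+1 - j))).

(* sigma_i sigma_{i+1} ... sigma_j, empty for (i, j) = (n + 1, n). *)
Definition wceil (i j : nat) : seq gen := map sigma (iota i (j.+1 - i)).

Definition h (i r : nat) : seq gen := wfloor i 1 ++ wceil r n.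

(* The sequence irs lists the pairs (i_1, r_1), ..., (i_p, r_p). *)
Definition nf_word (irs : seq (nat * nat)) (k j : nat) (wr : seq gen) :
    seq gen :=
  flatten [seq h ir.1 ir.2 ++ [:: aff] | ir <- irs]
  ++ flatten (nseq k (h j j.+1 ++ [:: aff])) ++ wr.

Definition condA (irs : seq (nat * nat)) : Prop :=
  [/\ sorted ltn ([seq ir.1 | ir <- irs] ++ rev [seq ir.2 | ir <- irs]),
      forall ir, ir \in irs -> ir.2 <= n.+1 &
      2 <= (last (0, 0) irs).2 - (last (0, 0) irs).1].

Definition condB (irs : seq (nat * nat)) (j : nat) : Prop :=
  let: (ip, rp) := last (0, 0) irs in
  (ip < j /\ j.+1 < rp) \/ j.+1 = rp.

(* The sequence d lists d_1, ..., d_z. *)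
Definition condC (j : nat) (wr : seq gen) : Prop :=
  exists d : seq nat, let z := size d in
  [/\ z <= n /\ j + z - 1 <= n,
      wr = flatten [seq wfloor (j + c) (nth 0 d c) | c <- iota 0 z],
      sorted ltn d /\ (forall x, x \in d -> 1 <= x <= n) &
      forall c, c < z -> nth 0 d c <= j + c].

(* The sequence lg lists the pairs (l_1, g_1), ..., (l_t, g_t). *)
Definition condD (irs : seq (nat * nat)) (wr : seq gen) : Prop :=
  let: (ip, rp) := last (0, 0) irs in
  exists lg : seq (nat * nat),
  let t := size lg in
  let l := [seq x.1 | x <- lg] in
  let g := [seq x.2 | x <- lg] in
  [/\ t <= n /\ wr = flatten [seq wfloor x.1 x.2 | x <- lg],
      sorted ltn l /\ sorted ltn g,
      forall x, x \in lg -> [/\ 1 <= x.1 <= n, 1 <= x.2 <= n & x.2 <= x.1],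
      0 < t -> ip < nth 0 l 0 < rp &
      forall i, 1 <= i < t -> (nth 0 l i.-1).+1 < nth 0 l i -> nth 0 l i < rp].

Definition normal_form (irs : seq (nat * nat)) (k j : nat) (wr : seq gen) :
    Prop :=
  let p := size irs in
  [/\ 1 <= j <= n,
      p = 0 -> 0 < k,
      0 < p -> condA irs,
      0 < p -> 0 < k -> condB irs j &
      if 0 < k then condC j wr else condD irs wr].

End AffineA.

(* Main.v *)
(* Call a word sparse if any two consecutive occurrences of a letter are
   separated by at least two of its neighbours (with multiplicity two when
   n = 1). Sparse words are exactly the reduced expressions of fully commutative
   elements; one direction is an induction based on the exchange property, which
   comes from the parity of the multiplicities in the list of reflections of a
   word. Moving the letters that need not precede the first a_{n+1} to its right
   turns a sparse word into h(i, r) a_{n+1} y. Such a word is sparse iff y is, the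
   first a_{n+1} of y (if any) has both its neighbours before it in y, and every
   letter that can be moved to the front of y lies strictly between i and r, or is
   i itself if r = i + 1. Iterating this gives (a) and (b); for the part without
   a_{n+1}, where the letters that can come first are l_1 and the l_i with
   l_i > l_{i-1} + 1, it gives (c) and (d). For uniqueness, the parameters are
   read off from the order of the first occurrences of neighbouring letters, which
   commutations do not change. *)
Require Import Defs.
From mathcomp Require Import all_boot.
From Stdlib Require Import Relation_Operators.
From mathcomp Require Import fingroup perm zify.
From mathcomp Require boolp.

Set Implicit Arguments.
Unset Strict Implicit.
Unset Printing Implicit Defensive.

(** * Reflections and the exchange property *)

Section Reflections.
Variables (T : choiceType) (m : coxeter_matrix T).
Implicit Types (s t q : T) (u v x z : seq T).
Local Notation W := (coxeter_group m).
Local Notation "`[ v ]" := (cprod m v) (at level 0, format "`[ v ]").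
Local Open Scope group_scope.

Lemma cprod_cat u v : `[u ++ v] = `[u] * `[v].
Proof. by symmetry; apply: cmulE. Qed.

Lemma cprod_cons s v : `[s :: v] = `[[:: s]] * `[v].
Proof. by rewrite -cprod_cat. Qed.

Lemma cprod_nil : `[[::]] = 1.
Proof. by []. Qed.

Lemma cprod_gen_sq s : `[[:: s]] * `[[:: s]] = 1.
Proof. by rewrite -cprod_cat; apply/cprodP/cox_eq_square. Qed.

Lemma cprod_genV s : `[[:: s]]^-1 = `[[:: s]].
Proof. exact: mulg1_eq (cprod_gen_sq s). Qed.

Lemma cprod_alternating s t k :
  `[flatten (nseq k [:: s; t])] = (`[[:: s]] * `[[:: t]]) ^+ k.
Proof.
elim: k => [//|k IH].
by rewrite expgS -IH /= cprod_cons (cprod_cons t) mulgA.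
Qed.

Lemma cprod_relator s t : (`[[:: s]] * `[[:: t]]) ^+ m s t = 1.
Proof.
rewrite -cprod_alternating; apply/cprodP; apply: rst_step.
by have := CoxStep m [::] [::] s t; rewrite cats0.
Qed.

(* The i-th entry is the reflection taking v to v with its i-th letter
   deleted. *)
Fixpoint refls v : seq W :=
  if v is s :: v' then `[[:: s]] :: [seq r ^ `[[:: s]] | r <- refls v']
  else [::].

Lemma size_refls v : size (refls v) = size v.
Proof. by elim: v => //= s v IH; rewrite size_map IH. Qed.

Lemma refls_cat u v :
  refls (u ++ v) = refls u ++ [seq r ^ `[u]^-1 | r <- refls v].
Proof.
elim: u => [|s u IH] /=.
  by rewrite cprod_nil invg1 -[LHS]map_id; apply: eq_map => r; rewrite conjg1.
rewrite IH map_cat -map_comp; congr (_ :: _ ++ _).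
apply: eq_map => r /=.
by rewrite [in RHS]cprod_cons invgM conjgM cprod_genV.
Qed.

Lemma refls_alternating s t k :
  refls (flatten (nseq k [:: s; t]))
  = [seq (`[[:: s]] * `[[:: t]]) ^+ i * `[[:: s]] | i <- iota 0 k.*2].
Proof.
set c := `[[:: s]] * `[[:: t]].
elim: k => [//|k IH]; rewrite doubleS /= IH expg0 mul1g.
congr [:: _, _ & _].
  by rewrite /c expg1 conjgE cprod_genV !mulgA.
rewrite (iotaDl 2 0) -!map_comp; apply: eq_map => i /=.
have ec : `[[:: t]] * `[[:: s]] = c^-1 by rewrite invgM !cprod_genV.
rewrite -conjgM ec conjgE invgK add2n expgSr expgS -!mulgA.
by congr (_ * (_ * _)); rewrite invgM !cprod_genV.
Qed.

(** As [(s t)^(m s t) = 1], the reflections [(s t)^i s] for [i < 2 (m s t)] run twice through the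
    same list. *)
Lemma odd_count_relator r s t :
  ~~ odd (count_mem r (refls (flatten (nseq (m s t) [:: s; t])))).
Proof.
rewrite refls_alternating -addnn iotaD map_cat count_cat add0n.
set F := fun i => _; have -> : map F (iota (m s t) (m s t)) = map F (iota 0 (m s t)).
  rewrite -[X in iota X _]addn0 iotaDl -map_comp; apply: eq_map => i.
  by rewrite /F /= expgnDr cprod_relator mul1g.
by rewrite oddD addbb.
Qed.

(** A relator has product 1, so inserting it leaves the other reflections unchanged, and it adds
    conjugates of its own reflections, each an even number of times. *)
Lemma odd_count_refls r u v :
  cox_eq m u v -> odd (count_mem r (refls u)) = odd (count_mem r (refls v)).
Proof.
elim=> {u v} [_ _ [u v s t]|//|u v _ -> //|u v z _ -> _ -> //].
set R := flatten _.
have eR : `[u ++ R] = `[u].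
  by rewrite cprod_cat cprod_alternating cprod_relator mulg1.
rewrite catA !refls_cat !count_cat !oddD eR; congr (_ (+) _).
rewrite -[RHS]addbF; congr (_ (+) _); apply/negbTE.
rewrite count_map (eq_count (a2 := pred1 (r ^ `[u]))) ?odd_count_relator //.
by move=> i /=; rewrite -(inj_eq (@conjg_inj _ `[u])) conjgKV.
Qed.

Lemma mem_refls r v : r \in refls v ->
  exists u q z, v = u ++ q :: z /\ r * `[u] = `[u ++ [:: q]].
Proof.
elim: v r => [//|s v IH] r; rewrite in_cons => /orP[/eqP->|/mapP[r' r'v ->]].
  by exists [::], s, v; rewrite cprod_nil mulg1.
have [u [q [z [-> e]]]] := IH _ r'v.
exists (s :: u), q, z; split=> //.
rewrite (cprod_cons s u) cat_cons (cprod_cons s (u ++ _)) -e conjgE cprod_genV.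
by rewrite -!mulgA (mulgA `[[:: s]] `[[:: s]]) cprod_gen_sq mul1g.
Qed.

Lemma reduced_wordE v :
  reduced_word m v <-> forall v', `[v'] = `[v] -> size v <= size v'.
Proof. by rewrite /reduced_word reduced_exprE; split=> [[]|]. Qed.

Lemma reduced_word_eq u v :
  `[u] = `[v] -> size u = size v -> reduced_word m u -> reduced_word m v.
Proof. by move=> e es /reduced_wordE ru; apply/reduced_wordE; rewrite -es -e. Qed.

Lemma reduced_word_behead s v : reduced_word m (s :: v) -> reduced_word m v.
Proof.
move=> /reduced_wordE r; apply/reduced_wordE => v' e.
by apply: (r (s :: v')); rewrite cprod_cons e -cprod_cons.
Qed.

Lemma cprod_delete r u q z :
  r * `[u] = `[u ++ [:: q]] -> `[u ++ q :: z] = r * `[u ++ z].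
Proof. by move=> e; rewrite -cat_rcons -cats1 !cprod_cat -cprod_cat -e mulgA. Qed.

(** If the first reflection occurred again, deleting both letters concerned would give a shorter
    expression of the same element. *)
Lemma reduced_refls_uniq v : reduced_word m v -> uniq (refls v).
Proof.
elim: v => [//|s v IH] red /=.
rewrite (map_inj_uniq (@conjg_inj _ _)) (IH (reduced_word_behead red)) andbT.
apply/negP => /mapP[r /mem_refls[u [q [z [ev e]]]] es].
have {es}er : r = `[[:: s]].
  apply: (@conjg_inj _ `[[:: s]]); rewrite -es conjgE.
  by rewrite cprod_gen_sq mulg1 cprod_genV.
move/reduced_wordE: red => /(_ (u ++ z)).
rewrite cprod_cons ev (cprod_delete _ e) er mulgA cprod_gen_sq mul1g.
by move=> /(_ erefl); rewrite /= !size_cat /=; lia.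
Qed.

(** Each reflection of [v] has multiplicity 1, so by parity it occurs in the list of every other
    expression, which is therefore at least as long. *)
Lemma refls_uniq_reduced v : uniq (refls v) -> reduced_word m v.
Proof.
move=> uv; apply/reduced_wordE => v' /cprodP e.
rewrite -(size_refls v) -(size_refls v'); apply: uniq_leq_size => // r rv.
have := odd_count_refls r e; rewrite (count_uniq_mem _ uv) rv /=.
by rewrite -has_pred1 has_count; case: (count _ _).
Qed.

(** The reflections of [s :: v] contain a repetition and those of [v] do not, so it is the
    reflection [s] that recurs; its position marks the letter to delete. *)
Lemma exchange s v : reduced_word m v -> ~ reduced_word m (s :: v) ->
  exists u q z, v = u ++ q :: z /\ `[v] = `[s :: u ++ z].
Proof.
move=> rv nr; have: ~~ uniq (refls (s :: v)).
  by apply/negP => /refls_uniq_reduced.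
rewrite /= (map_inj_uniq (@conjg_inj _ _)) (reduced_refls_uniq rv) andbT negbK.
case/mapP=> r /mem_refls[u [q [z [ev e]]]] es; exists u, q, z; split=> //.
rewrite {1}ev (cprod_delete _ e) [in RHS]cprod_cons; congr (_ * _).
apply: (@conjg_inj _ `[[:: s]]); rewrite -es conjgE.
by rewrite cprod_gen_sq mulg1 cprod_genV.
Qed.

(** The reflection [t] has multiplicity 1 in the list of [t :: u]; by parity it occurs in that of
    [v], at a letter [q] that can be traded for an initial [t]. *)
Lemma left_descent t u v :
  reduced_word m v -> reduced_word m (t :: u) -> `[v] = `[t :: u] ->
  exists x q z,
    [/\ v = x ++ q :: z, `[v] = `[t :: x ++ z] & `[t :: x] = `[x ++ [:: q]]].
Proof.
move=> rv ru /cprodP e; have := odd_count_refls `[[:: t]] e.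
rewrite !(count_uniq_mem _ (reduced_refls_uniq _)) // [in RHS]inE eqxx /=.
rewrite oddb => /mem_refls[x [q [z [ev e2]]]]; exists x, q, z.
by rewrite ev (cprod_delete _ e2) -cprod_cons -e2 -cprod_cons.
Qed.

Lemma cprod_consI s u v : `[s :: u] = `[s :: v] -> `[u] = `[v].
Proof. by rewrite cprod_cons (cprod_cons s v) => /mulgI. Qed.

End Reflections.

(** * Commutation classes and sparse words *)

Section Commutation.
Variables (T : choiceType) (m : coxeter_matrix T).
Implicit Types (s t : T) (u v x : seq T).

Lemma comm_eq_inv (X : Type) (f : seq T -> X) :
  (forall u s t v, m s t = 2 -> s != t ->
     f (u ++ s :: t :: v) = f (u ++ t :: s :: v)) ->
  forall u v, comm_eq m u v -> f u = f v.
Proof.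
move=> fP u v; elim=> {u v} [_ _ [u v s t st]|//|//|u v x _ -> _ -> //].
by rewrite /= fP //; apply/eqP => est; move: st; rewrite est cox_diag.
Qed.

Lemma comm_eq_refl u : comm_eq m u u.
Proof. exact: rst_refl. Qed.

Lemma comm_eq_sym u v : comm_eq m u v -> comm_eq m v u.
Proof. exact: rst_sym. Qed.

Lemma comm_eq_trans v u x : comm_eq m u v -> comm_eq m v x -> comm_eq m u x.
Proof. exact: rst_trans. Qed.

Lemma comm_eq_cat u u' v v' :
  comm_eq m u u' -> comm_eq m v v' -> comm_eq m (u ++ v) (u' ++ v').
Proof.
move=> uu' vv'; apply: (@rst_trans _ _ _ (u' ++ v)).
  elim: uu' => {u u'} [_ _ [x y s t st]|u|x y _ IH|x y z _ IH1 _ IH2].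
  - by rewrite -!catA; apply: rst_step; apply: CommStep.
  - exact: rst_refl.
  - exact: rst_sym.
  - exact: rst_trans IH2.
elim: vv' => {v v'} [_ _ [x y s t st]|v|x y _ IH|x y z _ IH1 _ IH2].
- by rewrite !(catA u'); apply: rst_step; apply: CommStep.
- exact: rst_refl.
- exact: rst_sym.
- exact: rst_trans IH2.
Qed.

Lemma comm_eq_catl x u v : comm_eq m u v -> comm_eq m (x ++ u) (x ++ v).
Proof. by move=> uv; apply: comm_eq_cat uv; apply: rst_refl. Qed.

Lemma comm_eq_cons s u v : comm_eq m u v -> comm_eq m (s :: u) (s :: v).
Proof. exact: (comm_eq_catl [:: s]). Qed.

Lemma comm_eq_swap s t v : m s t = 2 -> comm_eq m (s :: t :: v) (t :: s :: v).
Proof. by move=> st; apply: rst_step; apply: (CommStep [::] v st). Qed.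

Lemma comm_eq_push s u v :
  all (fun t => m s t == 2) u -> comm_eq m (s :: u ++ v) (u ++ s :: v).
Proof.
elim: u => [_|t u IH /= /andP[/eqP st us]]; first exact: rst_refl.
by apply: rst_trans (comm_eq_swap _ st) _; apply: comm_eq_cons; apply: IH.
Qed.

Lemma comm_eq_size u v : comm_eq m u v -> size u = size v.
Proof. by move=> /comm_eq_perm/perm_size. Qed.

Lemma comm_eq_cprod u v : comm_eq m u v -> cprod m u = cprod m v.
Proof.
apply: comm_eq_inv => {}u s t {}v st _.
rewrite (cprod_cat _ u) [RHS](cprod_cat _ u); congr (_ * _)%g.
rewrite (cprod_cons _ s) (cprod_cons _ t v) (cprod_cons _ t (s :: v)).
rewrite (cprod_cons _ s v) !mulgA; congr (_ * _)%g.
have := cprod_relator m s t; rewrite st expgS expg1 => /mulg1_eq <-.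
by rewrite invgM !cprod_genV.
Qed.

(** Deleting the first [s] turns an exchange into an exchange or an equality. This is what gives
    left cancellation in [comm_eq_catI]. *)
Lemma comm_eq_rem s u v : comm_eq m u v -> comm_eq m (rem s u) (rem s v).
Proof.
elim=> {u v} [_ _ [u v p q pq]|u|x y _ IH|x y z _ IH1 _ IH2].
- elim: u => [|t u IH] /=; last first.
    by case: ifP => _; [apply: rst_step; apply: CommStep | apply: comm_eq_cons].
  have npq : p != q by apply/eqP => e; move: pq; rewrite e cox_diag.
  case: (eqVneq p s) => [<-|ps].
    by rewrite eq_sym (negPf npq); apply: rst_refl.
  case: (eqVneq q s) => qs; first exact: rst_refl.
  exact: comm_eq_swap.
- exact: rst_refl.
- exact: rst_sym.
- exact: rst_trans IH2.
Qed.

Lemma comm_eq_catI x u v : comm_eq m (x ++ u) (x ++ v) -> comm_eq m u v.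
Proof. by elim: x => //= s x IH /(comm_eq_rem s); rewrite /= eqxx. Qed.

End Commutation.

(** * Neighbours in the cyclic diagram *)

Section Cycle.
Variable n : nat.
Implicit Types (l p q : nat) (s t : gen n) (u v w : seq (gen n)).
Local Notation M := (affA n).

(* Counted with multiplicity: this is 2 if n = 1 and l != p. *)
Definition edges l p : nat :=
  (l.+1 == p) + (p.+1 == l) + ((l == 0) && (p == n)) + ((p == 0) && (l == n)).

(* The number of edges from l to the letters preceding the first l in v, or at
   least 2 if l does not occur in v. *)
Fixpoint front l v : nat :=
  if v is s :: v' then if s == l :> nat then 0 else edges l s + front l v'
  else 2.

(* Between two consecutive occurrences of s there are at least two neighbours
   of s. *)
Fixpoint sparse v : bool :=
  if v is s :: v' then (1 < front s v') && sparse v' else true.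

Lemma edges_sym l p : edges l p = edges p l.
Proof. by rewrite /edges; lia. Qed.

Lemma gen_le s : s <= n.
Proof. by rewrite -ltnS. Qed.

Lemma val_sigma l : l <= n -> sigma n l = l :> nat.
Proof. by move=> ln; rewrite inordK. Qed.

Lemma front_cat l u v : front l (u ++ v) =
  if has (fun s => s == l :> nat) u then front l u
  else \sum_(s <- u) edges l s + front l v.
Proof.
elim: u => [|s u IH] /=; first by rewrite big_nil.
by case: eqP => //= _; rewrite IH big_cons; case: ifP => // _; lia.
Qed.

Lemma front_absent l v : ~~ has (fun s => s == l :> nat) v -> 1 < front l v.
Proof. by elim: v => //= s v IH; rewrite negb_or => /andP[/negPf-> /IH]; lia. Qed.

Lemma sparse_catr u v : sparse (u ++ v) -> sparse v.
Proof. by elim: u => //= s u IH /andP[_ /IH]. Qed.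

Hypothesis n_gt0 : 0 < n.

Lemma adjacentE s t : adjacent s t = (0 < edges s t).
Proof.
move: (gen_le s) (gen_le t); rewrite /adjacent /edges.
have modS l : l <= n -> l.+1 %% n.+1 = if l == n then 0 else l.+1.
  move=> ln; case: eqP => [->|]; first by rewrite modnn.
  by move=> lnn; rewrite modn_small //; lia.
move=> sn tn; rewrite !modS // !modn_small //.
by case: (eqVneq (s : nat) n); case: (eqVneq (t : nat) n); lia.
Qed.

Lemma affA_eq2 s t : (affA n s t == 2) = (s != t) && (edges s t == 0).
Proof.
move: (gen_le s) (gen_le t) => sn tn.
rewrite /= /affA_entry; case: (eqVneq s t) => [//|st /=].
have {}st : (s : nat) <> t by move=> /val_inj e; rewrite e eqxx in st.
case: (eqVneq n 1) => n1; first by rewrite /edges; lia.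
by rewrite adjacentE; case: posnP.
Qed.

Lemma affA_neq2 s t : edges s t != 0 -> 1 < n -> affA n s t = 3.
Proof.
move=> st n2; rewrite /= /affA_entry adjacentE lt0n st.
case: (eqVneq s t) st => [-> |_ _]; first by rewrite /edges; lia.
by case: eqP => //; lia.
Qed.

Lemma affA2P s t :
  affA n s t = 2 -> [/\ (s : nat) <> t, edges s t = 0 & edges t s = 0].
Proof.
move=> /eqP; rewrite affA_eq2 => /andP[/eqP st /eqP e].
by split=> //; [move=> /val_inj | rewrite edges_sym].
Qed.

Lemma affA2I s t : (s : nat) <> t -> edges s t = 0 -> affA n s t = 2.
Proof.
move=> st e; apply/eqP; rewrite affA_eq2 e eqxx andbT.
by apply/eqP => /(congr1 val).
Qed.

Lemma front_comm l u v : comm_eq M u v -> front l u = front l v.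
Proof.
move: u v; apply: comm_eq_inv => u s t v /affA2P[st e1 e2] _.
elim: u => [|q u IH] /=; last by rewrite IH.
by case: (eqVneq (s : nat) l) => [<-|_]; case: (eqVneq (t : nat) _) => [tl|_];
  rewrite -?tl; lia.
Qed.

Lemma sparse_comm u v : comm_eq M u v -> sparse u = sparse v.
Proof.
have fs x s t y : affA n s t = 2 ->
    forall l, front l (x ++ s :: t :: y) = front l (x ++ t :: s :: y).
  move=> st l; apply: front_comm; apply: comm_eq_catl; exact: comm_eq_swap.
move: u v; apply: comm_eq_inv => u s t v st _.
elim: u => [|q u IH] /=; last by rewrite IH (fs _ _ _ _ st).
have [est e1 e2] := affA2P st; rewrite e1 e2 !add0n.
case: (eqVneq (t : nat) s) => [|_]; first lia.
by case: (eqVneq (s : nat) t) => [|_]; [lia | rewrite andbCA].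
Qed.

End Cycle.

(** * Cyclic transpositions, separating the generators for [n > 1] *)

Lemma tperm_braid (T : finType) (a b c : T) : a != b -> b != c -> a != c ->
  ((tperm a b * tperm b c) ^+ 3 = 1)%g.
Proof.
move=> ab bc ac.
have e1 : (tperm b c ^ tperm a b = tperm a c)%g by rewrite tpermJ tpermR tpermD.
have e2 : (tperm a b ^ tperm b c = tperm a c)%g.
  by rewrite tpermJ tpermL tpermD // eq_sym.
rewrite !expgS expg0 mulg1 !mulgA.
have -> : (tperm a b * tperm b c * tperm a b = tperm a c)%g.
  by rewrite -e1 conjgE tpermV mulgA.
have -> : (tperm a c * tperm b c = tperm b c * tperm a b)%g.
  by rewrite -e2 conjgE tpermV -!mulgA tperm2 mulg1.
by rewrite -(mulgA _ (tperm a b) (tperm a b)) tperm2 mulg1 tperm2.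
Qed.

Lemma tperm_comm (T : finType) (a b c d : T) :
  a != c -> a != d -> b != c -> b != d ->
  ((tperm a b * tperm c d) ^+ 2 = 1)%g.
Proof.
move=> ac ad bc bd; rewrite !expgS expg0 mulg1.
have e : (tperm c d ^ tperm a b = tperm c d)%g.
  by rewrite tpermJ !tpermD // eq_sym.
rewrite -{1}e conjgE tpermV !mulgA tperm2 mul1g.
by rewrite -(mulgA _ (tperm a b) (tperm a b)) tperm2 mulg1 tperm2.
Qed.

Section PermutationRepresentation.
Variable n : nat.
Hypothesis n_gt1 : 1 < n.
Let n_gt0 : 0 < n := ltnW n_gt1.
Local Notation M := (affA n).
Implicit Types (s t : gen n) (u v : seq (gen n)).

Lemma val_ordS s : ordS s = (if s == n :> nat then 0 else s.+1) :> nat.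
Proof.
rewrite /=; case: eqP => [->|]; first by rewrite modnn.
by move=> sn; rewrite modn_small // ltnS; have := ltn_ord s; lia.
Qed.

Lemma edges_ordS s t : edges n s t != 0 -> ordS s = t \/ ordS t = s.
Proof.
have sn := gen_le s; have tn := gen_le t.
have := val_ordS s; have := val_ordS t; rewrite /edges => tS sS st.
have [e|ne] := eqVneq (ordS s : nat) t; first by left; apply: val_inj.
right; apply: val_inj => /=; rewrite -[LHS]/(nat_of_ord (ordS t)).
by move: tS sS ne; case: ifP; case: ifP; lia.
Qed.

(** The images of the generators under a homomorphism onto a finite symmetric group. It is not
    injective, but it distinguishes generators and detects those that do not commute. *)
Definition perm_of s : {perm gen n} := tperm s (ordS s).

Definition perm_rep v : {perm gen n} := (\prod_(s <- v) perm_of s)%g.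

Lemma perm_rep_relator s t : ((perm_of s * perm_of t) ^+ M s t = 1)%g.
Proof.
have sn := gen_le s; have tn := gen_le t.
have ne (a b : gen n) : (a : nat) <> b -> a != b by move=> h; apply/eqP => /(congr1 val).
have eqg (a b : gen n) : (a : nat) = b -> a = b := @val_inj _ _ _ a b.
have := val_ordS s; have := val_ordS t.
rewrite /perm_of -[M s t]/(affA_entry s t) /affA_entry.
case: (eqVneq s t) => [->|/eqP st] tS sS; first by rewrite expg1 tperm2.
have {}st : (s : nat) <> t by move=> /val_inj.
rewrite (_ : n == 1 = false); last by lia.
rewrite (adjacentE n_gt0) /edges; case: ifP => adj.
  have [e|e] : ordS s = t \/ ordS t = s by apply: edges_ordS; rewrite -lt0n.
    by rewrite e; apply: tperm_braid; apply: ne; move: tS sS; rewrite e;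
      case: ifP; case: ifP; lia.
  apply: invg_inj; rewrite invg1 -expgVn invgM !tpermV e tperm_braid //; apply: ne;
    by move: tS sS; rewrite e; case: ifP; case: ifP; lia.
by apply: tperm_comm; apply: ne; move: tS sS; case: ifP; case: ifP; lia.
Qed.

Lemma perm_rep_cat u v : perm_rep (u ++ v) = (perm_rep u * perm_rep v)%g.
Proof. by rewrite /perm_rep big_cat. Qed.

Lemma perm_rep_cprod u v : cprod M u = cprod M v -> perm_rep u = perm_rep v.
Proof.
move/cprodP; elim=> {u v} [_ _ [u v s t]|//|//|u v w _ -> _ -> //].
rewrite !perm_rep_cat.
suff -> : perm_rep (flatten (nseq (M s t) [:: s; t])) = 1%g by rewrite mul1g.
rewrite -(perm_rep_relator s t); elim: (M s t) => [|k IH].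
  by rewrite /perm_rep big_nil.
by rewrite expgS -IH /= /perm_rep !big_cons mulgA.
Qed.

Lemma cprod_gen_inj s t : cprod M [:: s] = cprod M [:: t] -> s = t.
Proof.
move=> /perm_rep_cprod; rewrite /perm_rep !big_seq1 /perm_of => e.
have sn := gen_le s; have tn := gen_le t.
have := val_ordS s; have := val_ordS t => tS sS.
have : tperm s (ordS s) s = tperm t (ordS t) s by rewrite e.
rewrite tpermL; case: tpermP => [//|es eo|_ _ eo]; move: sS tS; rewrite eo -?es;
  by case: ifP; case: ifP; lia.
Qed.

Lemma cprod_gen_neq s t : edges n s t != 0 ->
  cprod M [:: s; t] <> cprod M [:: t; s].
Proof.
wlog e : s t / ordS s = t => [hw|].
  move=> st; case: (edges_ordS st) => e; first exact: hw.
  by move=> e2; apply: (hw t s); rewrite // edges_sym.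
move=> _ /perm_rep_cprod; rewrite /perm_rep !big_cons !big_nil !mulg1 /perm_of.
(* With [t] the successor of [s], one product sends [s] to the successor of [t], the other sends it
   to [t]. *)
move/(congr1 (fun p : {perm gen n} => p s)); rewrite /= !permM tpermL e tpermL.
have sn := gen_le s; have tn := gen_le t.
have := val_ordS s; have := val_ordS t; rewrite e => tS tE.
rewrite (tpermD (z := s)).
- by rewrite -e tpermL e => /(congr1 val) /= h; move: tS; rewrite /= h; case: ifP; lia.
- by apply/eqP => h; move: tE; rewrite h; case: ifP; lia.
- by apply/eqP => h; move: tS tE; rewrite h; case: ifP; case: ifP; lia.
Qed.

End PermutationRepresentation.

(** * Sparse words are the reduced words of fully commutative elements *)

Section Criterion.
Variable n : nat.
Hypothesis n_gt0 : 0 < n.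
Local Notation M := (affA n).
Implicit Types (s t : gen n) (u v w x : seq (gen n)).

Definition rigid v := reduced_word M v /\
  forall u, reduced_word M u -> cprod M u = cprod M v -> comm_eq M v u.

Lemma rigidP v :
  rigid v <-> reduced_word M v /\ fully_commutative (cprod M v).
Proof.
split=> [[rv fv]|[rv /fully_commutativeE fv]]; split=> //.
  apply/fully_commutativeE => u u' ru ru'.
  have h x : reduced_expr (cprod M v) x -> comm_eq M v x.
    by move=> rx; have [e _] := (reduced_exprE _ _).1 rx; apply: fv => //;
      rewrite /reduced_word e.
  by apply: comm_eq_trans (h _ ru'); apply: comm_eq_sym; apply: h.
by move=> u ru e; apply: fv; rewrite // -e.
Qed.

(** Otherwise the exchange property gives a reduced expression of [v] starting with [s]. By rigidity
    commutations lead to it, so [s :: v] is equivalent to a word starting with [s s], which is not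
    sparse. *)
Lemma sparse_rigid_reduced s v : sparse (s :: v) -> rigid v ->
  reduced_word M (s :: v).
Proof.
move=> sp [rv fv]; apply: boolp.contrapT => nr.
have [x [q [z [ev e]]]] := exchange rv nr.
have : comm_eq M v (s :: x ++ z).
  apply: fv => //; apply: reduced_word_eq rv => //.
  by rewrite ev /= !size_cat /= addnS.
move=> /(comm_eq_cons s)/(sparse_comm n_gt0); rewrite sp /= eqxx.
by [].
Qed.

(** Induction on the length, comparing [s :: v] with another reduced expression [t :: u]. If [s] and
    [t] are distinct and commute, both can be brought to the front and the induction hypothesis
    applies to what follows. If they do not commute, [s :: v] is equivalent to a word starting with
    [s t s], which is not sparse as [s] and [t] are joined by a single edge. *)
Lemma sparse_rigid_simply_laced v : 1 < n -> sparse v -> rigid v.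
Proof.
move=> n_gt1; have [k] := ubnP (size v); elim: k v => // k IH [|s v] szk spv.
  split; first by apply/reduced_wordE.
  move=> u /reduced_wordE /(_ [::]) ru e; rewrite e in ru.
  by have := ru erefl; case: u {e ru} => // _; apply: comm_eq_refl.
have rgv : rigid v by apply: IH; [rewrite -ltnS | case/andP: spv].
have rsv := sparse_rigid_reduced spv rgv; split=> // -[|t u] ru e.
  by have := (reduced_wordE _ _).1 rsv _ e.
have su : size u = size v.
  apply/eqP; rewrite eqn_leq; move: (rsv) (ru) => /reduced_wordE h1 /reduced_wordE h2.
  by have := h1 _ e; have := h2 _ (esym e) => /=; rewrite !ltnS => -> ->.
have [ets|ts] := eqVneq t s.
  rewrite ets in e ru *; apply: comm_eq_cons; apply: rgv.2.
    exact: reduced_word_behead ru.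
  exact: cprod_consI e.
have [x [q [z [esv e1 e2]]]] := left_descent rsv ru (esym e).
case: x esv e1 e2 => [[sq _] _ /(cprod_gen_inj n_gt1) e2|].
  by rewrite e2 sq eqxx in ts.
move=> _ x [<- ev] e1 e2.
have sz : size v = (size (x ++ z)).+1 by rewrite ev !size_cat /= addnS.
case: (eqVneq (M s t) 2) => [st|/eqP st].
  have e3 : cprod M v = cprod M (t :: x ++ z).
    apply: (@cprod_consI _ _ s); rewrite e1; apply: comm_eq_cprod.
    by apply: comm_eq_swap; rewrite cox_sym.
  have c1 : comm_eq M (s :: v) (t :: s :: x ++ z).
    apply: comm_eq_trans (comm_eq_swap _ st); apply: comm_eq_cons.
    by apply: rgv.2 => //; apply: reduced_word_eq rgv.1.
  apply: (comm_eq_trans c1); apply: comm_eq_cons.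
  have : rigid (s :: x ++ z).
    apply: IH; first by rewrite /= -sz.
    by move: (spv); rewrite (sparse_comm n_gt0 c1) => /andP[].
  move=> [_]; apply; first exact: reduced_word_behead ru.
  by apply: (@cprod_consI _ _ t); rewrite e e1.
have nst : edges n s t != 0.
  by apply/eqP => e0; apply: st; apply: (affA2I n_gt0) => // /val_inj/eqP;
    rewrite eq_sym (negPf ts).
have rt : reduced_word M (t :: s :: x ++ z).
  by apply: reduced_word_eq rsv; rewrite // /= sz.
(* The letter traded for an initial [s] is not the leading [t], as [s] and [t] differ, nor the [s]
   after it, as they do not commute; so it lies further on. *)
have [y [p [z' [ets e3 e4]]]] := left_descent rt rsv (esym e1).
case: y ets e3 e4 => [[<- _] _ /(cprod_gen_inj n_gt1) e4|t' [|s' y]].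
- by rewrite e4 eqxx in ts.
- by case=> <- <- _ _ /(cprod_gen_neq n_gt1 nst).
move=> [<- <- ex] e3 _; exfalso.
have c1 : comm_eq M (s :: v) (s :: t :: s :: y ++ z').
  apply: comm_eq_cons; apply: rgv.2; last first.
    by apply: (@cprod_consI _ _ s); rewrite e1 e3.
  apply: reduced_word_eq rgv.1; first by apply: (@cprod_consI _ _ s); rewrite e1 e3.
  by rewrite sz ex /= !size_cat /= addnS.
move: spv; rewrite (sparse_comm n_gt0 c1) /= eqxx.
move: (gen_le s) (gen_le t); rewrite /edges; move/eqP: ts.
by have := @val_inj _ _ _ t s; case: (eqVneq (t : nat) s) => [|_ _ _]; [auto | lia].
Qed.

(* For n = 1 the group is the free product of two groups of order 2, and its
   normal forms are computed by cancelling equal adjacent letters. *)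
Definition cancel_push s v := if v is t :: v' then
  if t == s then v' else s :: v else [:: s].

Lemma sparse1_cons s v : n = 1 -> sparse (s :: v) = (ohead v != Some s) && sparse v.
Proof.
move=> n1; case: v => [//|t v] /=; congr (_ && _).
case: (eqVneq t s) => [->|ts]; first by rewrite !eqxx.
have {}ts : (t : nat) <> s by move/val_inj/eqP; rewrite (negPf ts).
rewrite (_ : _ == _ :> nat = false); last by apply/eqP.
rewrite (_ : Some t != Some s); last by apply/eqP => -[e]; rewrite e in ts.
by have := gen_le s; have := gen_le t; rewrite /edges; lia.
Qed.

(** For [n = 1] the squares are the only nonempty relators, so this makes the result of the
    cancellation depend on the group element alone. *)
Lemma cancel_pushK s v : n = 1 -> sparse v ->
  sparse (cancel_push s v) /\ cancel_push s (cancel_push s v) = v.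
Proof.
move=> n1; case: v => [|t v] sp; first by rewrite /= eqxx.
rewrite /cancel_push; case: (eqVneq t s) => [<-|ts]; last first.
  by rewrite sparse1_cons // eqxx sp andbT; split=> //=; apply/eqP => -[/eqP];
    rewrite (negPf ts).
move: sp; rewrite sparse1_cons // => /andP[tv ->]; split=> //.
by case: v tv => //= q v; case: (eqVneq q t) => // ->; rewrite eqxx.
Qed.

Lemma cancel_push_eq u v : n = 1 -> cox_eq M u v ->
  foldr cancel_push [::] u = foldr cancel_push [::] v.
Proof.
move=> n1; elim=> {u v} [_ _ [u v s t]|//|//|u v x _ -> _ -> //].
rewrite !foldr_cat; congr foldr.
rewrite -[M s t]/(affA_entry s t) /affA_entry (introT eqP n1).
case: (eqVneq s t) => [<-|//].
rewrite /=; have sp : sparse (foldr cancel_push [::] v).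
  by elim: v => //= q v IH; case: (cancel_pushK q n1 IH).
by case: (cancel_pushK s n1 sp).
Qed.

Lemma cancel_push_sparse v : n = 1 -> sparse v -> foldr cancel_push [::] v = v.
Proof.
move=> n1; elim: v => // s v IH; rewrite sparse1_cons // => /andP[sv sp].
rewrite /= IH //; case: v sv {IH sp} => //= t v.
by case: (eqVneq t s) => // ->; rewrite eqxx.
Qed.

Lemma size_cancel_push v : size (foldr cancel_push [::] v) <= size v.
Proof.
elim: v => //= s v; case: (foldr _ _ v) => //= t u; case: ifP => _ /=; lia.
Qed.

(** Every expression of the element cancels to [v]; one that is no longer than [v] undergoes no
    cancellation and equals [v]. *)
Lemma sparse_rigid_dihedral v : n = 1 -> sparse v -> rigid v.
Proof.
move=> n1 sp; have h u : cprod M u = cprod M v -> foldr cancel_push [::] u = v.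
  by move=> /cprodP /(cancel_push_eq n1)->; apply: cancel_push_sparse.
split; first by apply/reduced_wordE => u /h <-; apply: size_cancel_push.
move=> u ru eu; suff <- : u = v by apply: comm_eq_refl.
have es : size u <= size v by apply: (reduced_wordE _ _).1 ru _ (esym eu).
rewrite -(h u eu) in es *.
elim: u es {ru eu h} => //= s u IH.
have := size_cancel_push u; case: (foldr _ _ u) IH => [|t w] /= IH h1.
  by move=> h2; rewrite -IH //; lia.
by case: ifP => _ /= h2; [lia | rewrite -IH //; lia].
Qed.

(** If the first letter [s] violates sparsity, it recurs with at most one edge in between. Without
    an edge, commutations bring the two [s] together and the word is not reduced. With one edge, to
    a letter [t], they produce a factor [s t s]; the braid relation then gives a reduced expression
    with fewer [s]. *)
Lemma rigid_sparse v : rigid v -> sparse v.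
Proof.
elim: v => // s v IH [rsv fsv]; have rv := reduced_word_behead rsv.
have rgv : rigid v.
  split=> // u ru e; apply: (@comm_eq_catI _ _ [:: s]); apply: fsv.
    apply: reduced_word_eq rsv; first by rewrite (cprod_cons _ s u) e -(cprod_cons _ s v).
    congr _.+1; apply/eqP; rewrite eqn_leq.
    move: (rv) (ru) => /reduced_wordE h1 /reduced_wordE h2.
    by rewrite (h1 _ e) (h2 _ (esym e)).
  by rewrite (cprod_cons _ s u) e -(cprod_cons _ s v).
rewrite /= (IH rgv) andbT ltnNge; apply/negP => fs.
have sv : s \in v.
  apply: contraTT fs => sv; rewrite -ltnNge; apply: front_absent.
  by apply/hasPn => t tv; apply: contraNneq sv => /val_inj <-.
have [u [y [es sy ev]]] : exists u y,
  [/\ s \notin u, \sum_(t <- u) edges n s t <= 1 & v = u ++ s :: y].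
  move: fs sv; elim: v {IH rsv fsv rv rgv} => [//|t v IH] /=.
  rewrite in_cons; case: (eqVneq (t : nat) s) => [/val_inj -> _ _|ts fs /predU1P[e|sv]].
  - by exists [::], v; rewrite big_nil.
  - by rewrite e eqxx in ts.
  have [|u [y [su sy ev]]] := IH _ sv; first by lia.
  exists (t :: u), y; rewrite in_cons negb_or su andbT big_cons ev; split=> //.
    by apply: contraNneq ts => ->.
  move: fs; rewrite ev front_cat ifN /= ?eqxx ?addn0 //.
  by apply/hasPn => q qu; apply: contraNneq su => /val_inj <-.
have comm0 w : s \notin w -> \sum_(t <- w) edges n s t = 0 ->
    all (fun t => M s t == 2) w.
  elim: w => //= t w IHw; rewrite big_cons in_cons negb_or => /andP[st sw] e.
  rewrite IHw //; last by lia.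
  rewrite andbT; apply/eqP; apply: affA2I => //; last by lia.
  by move/val_inj/eqP; rewrite (negPf st).
have [e0|e1] := posnP (\sum_(t <- u) edges n s t).
  have /comm_eq_cprod e : comm_eq M (s :: v) (u ++ s :: s :: y).
    by rewrite ev; apply: comm_eq_push; apply: comm0.
  move/reduced_wordE: rsv => /(_ (u ++ y)); rewrite e ev.
  rewrite (cprod_cat _ u y) (cprod_cat _ u (_ :: _)) (cprod_cons _ s (s :: y)).
  rewrite (cprod_cons _ s y) (mulgA (cprod M [:: s])) cprod_gen_sq mul1g.
  by move=> /(_ erefl); rewrite /= !size_cat /=; lia.
have [u1 [t [u2 [eu s1 st s2]]]] : exists u1 t u2,
  [/\ u = u1 ++ t :: u2, \sum_(t <- u1) edges n s t = 0, edges n s t = 1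
    & \sum_(t <- u2) edges n s t = 0].
  move: e1 sy; elim: u {es ev} => [|t u IHu]; rewrite ?big_nil // big_cons => e1 sy.
  have [e0|et] := posnP (edges n s t).
    have [||u1 [q [u2 [-> h1 h2 h3]]]] := IHu; try lia.
    by exists (t :: u1), q, u2; rewrite big_cons e0.
  by exists [::], t, u; rewrite big_nil; split=> //; lia.
move: es; rewrite eu mem_cat in_cons !negb_or => /and3P[su1 nst su2].
(* For [n = 1] distinct letters are joined by two edges, whereas [t] contributes exactly one. *)
have n_gt1 : 1 < n.
  have {}nst : (s : nat) <> t by move/val_inj/eqP; rewrite (negPf nst).
  by move: st (gen_le s) (gen_le t); rewrite /edges; lia.
have c1 : comm_eq M (s :: v) (u1 ++ s :: t :: s :: u2 ++ y).
  rewrite ev eu -catA /=; apply: comm_eq_trans (comm_eq_push _ (comm0 _ su1 s1)) _.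
  do 3![apply: comm_eq_catl || apply: comm_eq_cons].
  by apply: comm_eq_sym; apply: comm_eq_push; apply: comm0.
have braid : cprod M [:: s; t; s] = cprod M [:: t; s; t].
  have := cprod_alternating M s t 3.
  rewrite -[X in (_ ^+ X)%g](affA_neq2 n_gt0 (s := s) (t := t)) ?st //.
  rewrite cprod_relator (cprod_cat _ [:: s; t; s] [:: t; s; t]) => /mulg1_eq <-.
  by apply/esym/cinvE.
have e2 : cprod M (u1 ++ t :: s :: t :: u2 ++ y) = cprod M (s :: v).
  rewrite (comm_eq_cprod c1) !(cprod_cat _ u1); congr (_ * _)%g.
  by rewrite (cprod_cat _ [:: s; t; s]) (cprod_cat _ [:: t; s; t]) braid.
have c2 : comm_eq M (s :: v) (u1 ++ t :: s :: t :: u2 ++ y).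
  apply: fsv => //; apply: reduced_word_eq rsv => //.
  by rewrite (comm_eq_size c1) !size_cat.
have := comm_eq_trans (comm_eq_sym c1) c2 => /comm_eq_perm/seq.permP/(_ (pred1 s)).
rewrite !count_cat /= eqxx eq_sym (negPf nst); lia.
Qed.

Lemma sparseP v :
  sparse v <-> reduced_word M v /\ fully_commutative (cprod M v).
Proof.
rewrite -rigidP; split; last exact: rigid_sparse.
have [n1|n1] := eqVneq n 1; first exact: sparse_rigid_dihedral.
by apply: sparse_rigid_simply_laced; lia.
Qed.

End Criterion.

(** * The blocks h(i, r) a_{n+1} *)

Section Blocks.
Variable n : nat.
Hypothesis n_gt0 : 0 < n.
Local Notation M := (affA n).
Local Notation sg := (sigma n).
Local Notation af := (aff n).
Implicit Types (s t : gen n) (u v w x y : seq (gen n)) (i j k l r : nat).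

Lemma wfloor_nil i j : i < j -> wfloor n i j = [::].
Proof. by move=> ij; rewrite /wfloor (_ : i.+1 - j = 0) //; lia. Qed.

Lemma wfloorS i j : j <= i.+1 -> wfloor n i.+1 j = sg i.+1 :: wfloor n i j.
Proof.
move=> ji; rewrite /wfloor subSn // -(addn1 (_ - _)) iotaD rev_cat /=.
by rewrite subnKC.
Qed.

Lemma wceil_nil i j : j < i -> wceil n i j = [::].
Proof. by move=> ij; rewrite /wceil (_ : j.+1 - i = 0) //; lia. Qed.

Lemma wceil_cons i j : i <= j -> wceil n i j = sg i :: wceil n i.+1 j.
Proof. by move=> ij; rewrite /wceil subSn //= subSS. Qed.

Lemma front_sigma l i v : i <= n ->
  front l (sg i :: v) = if i == l then 0 else edges n l i + front l v.
Proof. by move=> le_in; rewrite /= val_sigma. Qed.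

Lemma front_aff l v : front l (af :: v) = if l == 0 then 0 else (l == 1) + (l == n) + front l v.
Proof. by rewrite /= /edges; case: l => [|l] //=; lia. Qed.

Lemma front_wfloor l i j v : 0 < l -> 0 < j -> i <= n ->
  front l (wfloor n i j ++ v) =
  if j <= l <= i then nat_of_bool (l < i)
  else ((j <= i) && (l == i.+1)) + ((j <= i) && (l.+1 == j)) + front l v.
Proof.
move=> l0 j0; elim: i => [|i IH] le_in.
  by rewrite wfloor_nil // cat0s ifN; lia.
have [ji|ji] := leqP j i.+1; last by rewrite wfloor_nil // cat0s ifN; lia.
rewrite wfloorS // cat_cons front_sigma // IH; last exact: ltnW.
rewrite /edges; have [il|il] := eqVneq i.+1 l; first by rewrite -il ji leqnn ltnn.
by case: ifP; case: ifP; lia.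
Qed.

Lemma front0_wfloor i j v : 0 < j -> i <= n ->
  front 0 (wfloor n i j ++ v) =
  ((j <= i) && (j == 1)) + ((j <= i) && (i == n)) + front 0 v.
Proof.
move=> j0; elim: i => [|i IH] le_in.
  by rewrite wfloor_nil // cat0s; lia.
have [ji|ji] := leqP j i.+1; last by rewrite wfloor_nil // cat0s; lia.
by rewrite wfloorS // cat_cons front_sigma //= IH; rewrite /edges; lia.
Qed.

Lemma front_wceil l r v : 0 < l <= n -> 0 < r ->
  front l (wceil n r n ++ v) =
  if r <= l then nat_of_bool (r < l)
  else (r <= n) && (l.+1 == r) + front l v.
Proof.
move=> ln; have [k] := ubnP (n.+1 - r); elim: k r => // k IH r rk r0.
have [rn|rn] := leqP r n; last by rewrite wceil_nil // cat0s ifN; lia.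
rewrite wceil_cons // cat_cons front_sigma // IH //; last by lia.
rewrite /edges; have [il|il] := eqVneq r l; first by rewrite -il leqnn ltnn.
by case: ifP; case: ifP; lia.
Qed.

Lemma front0_wceil r v : 1 < r ->
  front 0 (wceil n r n ++ v) = (r <= n) + front 0 v.
Proof.
have [k] := ubnP (n.+1 - r); elim: k r => // k IH r rk r0.
have [rn|rn] := leqP r n; last by rewrite wceil_nil // cat0s; lia.
rewrite wceil_cons // cat_cons front_sigma // IH //; try lia.
by rewrite /edges; case: eqP => ?; lia.
Qed.

(** A letter [l] of the run, unless it is the last, is followed by its neighbour [l - 1]; any
    further neighbour before the next [l] must come from [v]. *)
Lemma sparse_wfloor i j v : 0 < j -> i <= n ->
  sparse (wfloor n i j ++ v) <->
  sparse v /\ forall l, j <= l <= i -> 1 < (j < l) + front l v.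
Proof.
move=> j0; elim: i => [|i IH] le_in.
  by rewrite wfloor_nil //; split=> [|[]] // sp; split=> // l; lia.
have [ji|ji] := leqP j i.+1; last first.
  by rewrite wfloor_nil //; split=> [|[]] // sp; split=> // l; lia.
rewrite wfloorS //= val_sigma // front_wfloor //; try lia.
rewrite ifN; last by lia.
split=> [/andP[f1 /IH[|sp h]]|[sp h]]; first by lia.
  split=> // l jl; have [il|il] := eqVneq l i.+1; last by apply: h; lia.
  by rewrite il; lia.
apply/andP; split; last by apply/IH; [lia | split=> // l ?; apply: h; lia].
by have := h i.+1; lia.
Qed.

Lemma sparse_wceil r v : 0 < r ->
  sparse (wceil n r n ++ v) <->
  sparse v /\ forall l, r <= l <= n -> 1 < (l < n) + front l v.
Proof.
have [k] := ubnP (n.+1 - r); elim: k r => // k IH r rk r0.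
have [rn|rn] := leqP r n; last first.
  by rewrite wceil_nil //; split=> [|[]] // sp; split=> // l; lia.
rewrite wceil_cons //= val_sigma // front_wceil //; try lia.
rewrite ifN; last by lia.
split=> [/andP[f1 /IH[||sp h]]|[sp h]]; try lia.
  split=> // l jl; have [->|rl] := eqVneq l r; first by lia.
  by apply: h; lia.
apply/andP; split; first by have := h r; lia.
by apply/IH; [lia | lia | split=> // l ?; apply: h; lia].
Qed.

(* The pairs (i, r) for which the paper defines h i r; as h 0 1 and h 1 2 are the
   same word, (0, 1) is excluded. *)
Definition is_block (b : nat * nat) := [&& b.1 < b.2, b.2 <= n.+1 & 1 < b.2].

(* The letters that can start what follows h i r a_{n+1}. *)
Definition allowed (b : nat * nat) l :=
  if b.2 == b.1.+1 then l == b.1 else b.1 < l < b.2.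

Lemma h_catE i r v : h n i r ++ v = wfloor n i 1 ++ wceil n r n ++ v.
Proof. by rewrite /h catA. Qed.

Lemma front_block l b y : is_block b -> 0 < l <= n ->
  front l (h n b.1 b.2 ++ af :: y) =
  if l <= b.1 then nat_of_bool (l < b.1)
  else (0 < b.1) && (l == b.1.+1) +
    (if b.2 <= l then nat_of_bool (b.2 < l)
     else (b.2 <= n) && (l.+1 == b.2) + (l == 1) + (l == n) + front l y).
Proof.
case: b => i r /and3P[/= ir rn r1] ln /=.
rewrite h_catE front_wfloor ?front_wceil ?front_aff; try lia.
rewrite (_ : (l == 0) = false); last by lia.
by do ![case: ifP]; lia.
Qed.

Lemma front0_block b y : is_block b ->
  front 0 (h n b.1 b.2 ++ af :: y) = (0 < b.1) + (b.1 == n) + (b.2 <= n).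
Proof.
case: b => i r /and3P[/= ir rn r1].
by rewrite h_catE front0_wfloor ?front0_wceil ?front_aff //=; lia.
Qed.

(** A letter of [h(i, r)] is followed by one neighbour in the block or by [a_{n+1}] as its
    neighbour, and needs another one in [y]; only [i] with [r = i + 1] has two already. Letters
    strictly between [i] and [r] are absent from the block and unconstrained. *)
Lemma sparse_block b y : is_block b ->
  sparse (h n b.1 b.2 ++ af :: y) <->
  [/\ sparse y, 1 < front 0 y &
      forall l, 0 < l <= n -> ~~ allowed b l -> 0 < front l y].
Proof.
case: b => i r /and3P[/= ir rn r1]; rewrite /allowed /= h_catE.
have E l : 0 < l <= n -> front l (af :: y) = (l == 1) + (l == n) + front l y.
  by move=> ln; rewrite front_aff (_ : (l == 0) = false); last lia.
rewrite sparse_wfloor ?sparse_wceil; try lia; split.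
  move=> [[/andP[f0 sp] h2] h1]; split=> // l ln.
  case: (leqP r l) => [rl _|lr]; first by have := h2 l; rewrite E //; lia.
  case: (leqP l i) => [li|li]; last by case: ifP; lia.
  have := h1 l; rewrite front_wceil; try lia; rewrite ifN; last by lia.
  by rewrite E //; case: ifP; lia.
move=> [sp f0 h1]; split=> [|l ln].
  split=> [|l ln]; first by rewrite /= sp andbT.
  by have := h1 l; rewrite E; try lia; case: ifP; lia.
rewrite front_wceil; try lia; rewrite ifN; last by lia.
by have := h1 l; rewrite E; try lia; case: ifP; lia.
Qed.

(** The letters that can start [h(i', r') a_{n+1}] are [i'] and, if [r'] is not [i' + 1], also [r'].
    For valid blocks the values [i' = 0] and, in the latter case, [r' = n + 1] are never [allowed];
    this is the requirement that [a_{n+1}] have both neighbours before it. *)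
Definition follows (b c : nat * nat) :=
  allowed b c.1 && ((c.2 == c.1.+1) || allowed b c.2).

Lemma followsP b c y : is_block b -> is_block c ->
  follows b c <->
  1 < front 0 (h n c.1 c.2 ++ af :: y) /\
  forall l, 0 < l <= n -> ~~ allowed b l ->
    0 < front l (h n c.1 c.2 ++ af :: y).
Proof.
move=> bb bc; rewrite front0_block // /follows /allowed.
have F l := @front_block l c y bc.
case: b bb => i r /and3P[/= ir rn r1]; case: c bc F => i' r' /and3P[/= ir' rn' r1'] F.
split.
  move=> hf; split; first by move: hf; case: ifP; lia.
  by move=> l ln; rewrite F //; move: hf; do ![case: ifP]; lia.
move=> [f0 f1]; have := f1 i'; have := f1 r'.
have [e|ne] := eqVneq r' i'.+1.
  by move=> _; rewrite F; try lia; do ![case: ifP]; lia.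
by rewrite !F; try lia; do ![case: ifP]; lia.
Qed.

Definition bword (bs : seq (nat * nat)) v :=
  flatten [seq h n b.1 b.2 ++ [:: af] | b <- bs] ++ v.

Lemma bword_cons b bs v : bword (b :: bs) v = h n b.1 b.2 ++ af :: bword bs v.
Proof. by rewrite /bword /= -!catA. Qed.

Lemma nf_wordE irs k j wr :
  nf_word irs k j wr = bword (irs ++ nseq k (j, j.+1)) wr.
Proof.
rewrite /nf_word /bword map_cat flatten_cat -catA; congr (_ ++ (_ ++ _)).
by rewrite map_nseq.
Qed.

Lemma front0_noaff v : af \notin v -> 1 < front 0 v.
Proof.
move=> av; apply: front_absent; apply/hasPn => s sv.
by apply: contraNneq av => s0; rewrite (_ : af = s) //; apply: val_inj.
Qed.

Lemma sparse_bword b bs wr : all is_block (b :: bs) -> af \notin wr ->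
  sparse (bword (b :: bs) wr) <->
  [/\ sparse wr, path follows b bs &
      forall l, 0 < l <= n -> ~~ allowed (last b bs) l -> 0 < front l wr].
Proof.
move=> + aw; elim: bs b => [|c bs IH] b /= /andP[bb].
  rewrite bword_cons sparse_block // => _.
  by split=> [[? _ ?]|[? _ ?]]; split=> //; apply: front0_noaff.
move=> bbs; have bc : is_block c by case/andP: bbs.
rewrite bword_cons sparse_block //; split.
  move=> [/(IH _ bbs)[sp pc fl] f0 fb]; split=> //.
  rewrite pc andbT; apply/(followsP (bword bs wr)) => //.
  by rewrite -bword_cons.
move=> [sp /andP[/(followsP (bword bs wr) bb bc)] + pc fl].
by rewrite -bword_cons => -[f0 fb]; split=> //; apply/IH.
Qed.

End Blocks.

(** * Extracting blocks, and the part without a_{n+1} *)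

Section Existence.
Variable n : nat.
Hypothesis n_gt0 : 0 < n.
Local Notation M := (affA n).
Local Notation sg := (sigma n).
Local Notation af := (aff n).
Implicit Types (s t : gen n) (u v w y : seq (gen n)) (i j k l r : nat).

Lemma sigmaK s : sg s = s.
Proof. exact: inord_val. Qed.

Lemma wfloor1 s : 0 < s -> wfloor n s s = [:: s].
Proof.
move=> s0; rewrite -[in RHS](sigmaK s); case: (s : nat) s0 => // k _.
by rewrite wfloorS // wfloor_nil.
Qed.

Lemma mem_wfloor s i j : i <= n -> (s \in wfloor n i j) = (j <= s <= i).
Proof.
move=> le_in; apply/mapP/idP => [[l]|sji].
  by rewrite mem_rev mem_iota => lij ->; rewrite val_sigma; lia.
by exists (s : nat); rewrite ?sigmaK // mem_rev mem_iota; lia.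
Qed.

Lemma mem_wceil s r : 0 < r -> (s \in wceil n r n) = (r <= s).
Proof.
move=> r0; have sn := gen_le s; apply/mapP/idP => [[l]|sji].
  by rewrite mem_iota => lij ->; rewrite val_sigma; lia.
by exists (s : nat); rewrite ?sigmaK // mem_iota; lia.
Qed.

Lemma mem_h s i r : 0 < r -> i <= n -> (s \in h n i r) = (0 < s <= i) || (r <= s).
Proof. by move=> r0 le_in; rewrite mem_cat mem_wfloor // mem_wceil. Qed.

Lemma gen_neq0 s : s != af -> 0 < s.
Proof. by rewrite lt0n; apply: contraNneq => s0; apply/eqP/val_inj. Qed.

(** Letters are prefixed one by one to the empty block [h(0, n + 1)]. Sparsity forces [i < s < r]
    for the new letter [s]. If [s = i + 1] or [s = r - 1], it lengthens the first or the second
    factor; otherwise it commutes with the block and with [a_{n+1}] and moves to their right. *)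
Lemma comm_block u y : af \notin u -> sparse (u ++ af :: y) ->
  exists b z, is_block n b /\ comm_eq M (u ++ af :: y) (h n b.1 b.2 ++ af :: z).
Proof.
elim: u => [_ _|s u IH].
  exists (0, n.+1), y; rewrite /is_block /= /h wfloor_nil // wceil_nil //.
  by split; [lia | apply: comm_eq_refl].
rewrite in_cons negb_or eq_sym => /andP[/gen_neq0 s0 au] spu.
have [|b [z [bb c]]] := IH au; first by case/andP: spu.
have cs := comm_eq_cons s c.
have : 1 < front s (h n b.1 b.2 ++ af :: z).
  by move: spu; rewrite [_ ++ _]/= (sparse_comm n_gt0 cs) => /andP[].
have sn := gen_le s; rewrite front_block ?s0 //.
case: b bb c cs => i r bb c cs; case/and3P: (bb) => /= ir rn r1 f.
have {f}[is_ sr] : i < s /\ s < r by move: f; do ![case: ifP]; lia.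
have [si|si] := eqVneq (s : nat) i.+1.
  exists (s : nat, r), z; split; first by apply/and3P.
  by move: cs; rewrite /h /= si wfloorS // -si sigmaK.
(* As [s] is not [i + 1], it commutes with the whole first factor and can reach the second. *)
have [rs|rs] := eqVneq r s.+1.
  exists (i, s : nat), z; split; first by apply/and3P; split=> /=; lia.
  apply: comm_eq_trans cs _; rewrite /h /= -!catA (wceil_cons _ sn) sigmaK -rs.
  apply: comm_eq_push; apply/allP => t; rewrite mem_wfloor; last by lia.
  by move=> ti; apply/eqP/affA2I => //; [lia | rewrite /edges; lia].
exists (i, r), (s :: z); split=> //; apply: comm_eq_trans cs _.
rewrite -(cat_rcons af _ z) -(cat_rcons af _ (s :: z)).
apply: comm_eq_push; apply/allP => t.
rewrite mem_rcons in_cons mem_h /=; try lia; move=> ht.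
have {}ht : [|| 0 < t <= i, r <= t | (t : nat) == 0].
  by case/orP: ht => [/eqP->|/orP[]->]; rewrite ?orbT.
by have tn := gen_le t; apply/eqP/affA2I => //; [lia | rewrite /edges; lia].
Qed.

Definition runs (lg : seq (nat * nat)) := flatten [seq wfloor n q.1 q.2 | q <- lg].
Arguments runs : simpl never.

Definition is_run (x : nat * nat) := [&& 0 < x.2, x.2 <= x.1 & x.1 <= n].

(** Runs with strictly increasing tops and bottoms form the usual normal form of fully commutative
    elements of [W(A_n)]. *)
Definition below (p q : nat * nat) := (p.1 < q.1) && (p.2 < q.2).

Lemma runs_cons x lg : runs (x :: lg) = wfloor n x.1 x.2 ++ runs lg.
Proof. by []. Qed.

(** The letter [s] is not in the first run, as at most one neighbour would precede it there. If
    [s = l + 1] it lengthens this run, if [s < g] it becomes a run of its own, and if [s > l + 1] it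
    commutes past the run. *)
Lemma insert_run s lg p : 0 < s -> p.1 < s -> p.2 < s ->
  path below p lg -> all is_run lg -> 1 < front s (runs lg) ->
  exists lg', [/\ path below p lg', all is_run lg'
                & comm_eq M (runs lg') (s :: runs lg)].
Proof.
have sn := gen_le s.
elim: lg p => [|[l g] lg IH] p s0 p1 p2 /=.
  move=> _ _ _; exists [:: (s : nat, s : nat)]; split=> /=.
  - by rewrite andbT; apply/andP.
  - by rewrite andbT; apply/and3P.
  by rewrite runs_cons /= wfloor1 //; apply: comm_eq_refl.
move=> /andP[/andP[/= pl pg] plg] /andP[/and3P[/= g0 gl ln] alg].
rewrite runs_cons front_wfloor //=; case: ifP => [|sgl f1]; first by case: (s < l).
have [sl|sl] := eqVneq (s : nat) l.+1.
  exists ((s : nat, g) :: lg); split=> /=.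
  - rewrite /below /= p1 pg /=.
    (* The next run cannot have top [l + 1] as well: this [s] would be preceded by only one
       neighbour. *)
    case: lg plg alg f1 {IH} => //= -[l2 g2] lg /andP[/andP[/= ll gg] plg].
    move=> /andP[/and3P[/= g20 gl2 l2n] _]; rewrite gg plg !andbT runs_cons.
    by rewrite front_wfloor //=; case: ifP; lia.
  - by rewrite alg andbT; apply/and3P; split=> /=; lia.
  rewrite !runs_cons /= sl wfloorS; last by lia.
  by rewrite -sl sigmaK; apply: comm_eq_refl.
have [sg_|sg_] := ltnP s g.
  exists ((s : nat, s : nat) :: (l, g) :: lg); split=> /=.
  - by rewrite /below /= p1 p2 plg; lia.
  - by rewrite alg /is_run /=; lia.
  by rewrite !runs_cons /= wfloor1 //; apply: comm_eq_refl.
have [|||lg' [plg' alg' c]] := IH (l, g) s0 _ _ plg alg; try by move=> /=; lia.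
exists ((l, g) :: lg'); split=> /=.
- by rewrite plg' /below /= pl pg.
- by rewrite alg' andbT; apply/and3P.
rewrite !runs_cons; apply: comm_eq_trans (comm_eq_catl _ c) _.
apply: comm_eq_sym; apply: comm_eq_push; apply/allP => t; rewrite mem_wfloor //=.
by move=> tl; apply/eqP/affA2I => //; [lia | rewrite /edges; lia].
Qed.

Lemma comm_runs y : af \notin y -> sparse y ->
  exists lg, [/\ path below (0, 0) lg, all is_run lg & comm_eq M (runs lg) y].
Proof.
elim: y => [|s y IH]; first by exists [::]; split=> //; apply: comm_eq_refl.
rewrite in_cons negb_or eq_sym => /andP[/gen_neq0 s0 ay] /= /andP[f sp].
have [lg [plg alg c]] := IH ay sp.
rewrite -(front_comm n_gt0 s c) in f.
have [lg' [plg' alg' c']] := insert_run s0 (p := (0, 0)) s0 s0 plg alg f.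
exists lg'; split=> //; apply: comm_eq_trans c' _; exact: comm_eq_cons.
Qed.

(** The last requirement of (d). On an increasing sequence [r = 0] forces consecutive values, as in
    (c). *)
Definition gap r i j := (i.+1 < j) ==> (j < r).

Lemma front_runs_le p lg l : path below p lg -> all is_run lg ->
  0 < l <= p.1 -> 0 < front l (runs lg).
Proof.
elim: lg p => [//|[k g] lg IH] p /= /andP[/andP[/= pk pg] plg].
move=> /andP[/and3P[/= g0 gk kn] alg] lp; rewrite runs_cons front_wfloor //=; last by lia.
by case: ifP; [lia | have := IH _ plg alg; rewrite /=; lia].
Qed.

Lemma front_runs_gt1 p lg l : path below p lg -> all is_run lg ->
  0 < l <= p.2 -> 1 < front l (runs lg).
Proof.
elim: lg p => [//|[k g] lg IH] p /= /andP[/andP[/= pk pg] plg].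
move=> /andP[/and3P[/= g0 gk kn] alg] lp; rewrite runs_cons front_wfloor //=; last by lia.
by rewrite ifN; [have := IH _ plg alg; rewrite /=; lia | lia].
Qed.

(** The bottom of a run does not recur later. Any other letter of the run is followed by its lower
    neighbour, and a recurrence is preceded by its upper neighbour in a run with a higher top. *)
Lemma sparse_runs p lg : path below p lg -> all is_run lg -> sparse (runs lg).
Proof.
elim: lg p => [//|[k g] lg IH] p /= /andP[_ plg].
move=> /andP[/and3P[/= g0 gk kn] alg]; rewrite runs_cons /=; apply/sparse_wfloor => //.
split=> [|l lk]; first exact: IH plg alg.
have := @front_runs_le _ _ l plg alg; have := @front_runs_gt1 _ _ l plg alg.
by rewrite /=; lia.
Qed.

Lemma front_runs_gap r p lg : path below p lg -> all is_run lg ->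
  (forall l, p.1.+1 < l <= n -> r <= l -> 0 < front l (runs lg)) <->
  path (gap r) p.1 [seq q.1 | q <- lg].
Proof.
elim: lg p => [//|[k g] lg IH] p /= /andP[/andP[/= pk pg] plg].
move=> /andP[/and3P[/= g0 gk kn] alg]; rewrite runs_cons /=; have {}IH := IH _ plg alg.
have F l (l0 : 0 < l) := front_wfloor n_gt0 (runs lg) l0 g0 kn.
split=> [f|/andP[kr /IH f] l pl rl].
  apply/andP; split.
    by apply/implyP => pk1; rewrite ltnNge; apply/negP => rk;
      have := f k; rewrite F ?ifT; lia.
  by apply/IH => l /= kl rl; have := f l; rewrite F; try lia; case: ifP; lia.
rewrite F; last by lia.
have := @front_runs_le _ _ l plg alg; have := f l; rewrite /= => f1 f2.
by move: kr; rewrite /gap; case: ifP; lia.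
Qed.

(** The letters that can come first are [k] and the tops that exceed the previous top by more than
    one. If [b] is [(j, j + 1)], only [j] may come first, so no such gap can occur; otherwise these
    later tops already exceed [b.1] and only the bound [b.2] remains. *)
Lemma front_runs_allowed b k g lg :
  path below (k, g) lg -> all is_run ((k, g) :: lg) ->
  (forall l, 0 < l <= n -> ~~ allowed b l -> 0 < front l (runs ((k, g) :: lg)))
  <-> allowed b k /\
      path (gap (if b.2 == b.1.+1 then 0 else b.2)) k [seq q.1 | q <- lg].
Proof.
move=> plg /= /andP[/and3P[/= g0 gk kn] alg]; rewrite runs_cons /=.
have F l (l0 : 0 < l) := front_wfloor n_gt0 (runs lg) l0 g0 kn.
split.
  move=> f; have ak : allowed b k.
    by apply/negPn/negP => nak; have := f k; rewrite F ?ifT; lia.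
  split=> //; apply/(front_runs_gap _ plg alg) => l /= kl rl.
  have := f l; rewrite F; try lia; move: ak; rewrite /allowed.
  by move: rl; do ![case: ifP]; lia.
move=> [ak /(front_runs_gap _ plg alg) f] l ln nal; rewrite F; last by lia.
have := @front_runs_le _ _ l plg alg; have := f l; rewrite /= => f1 f2.
by move: nal ak f1; rewrite /allowed; do ![case: ifP]; lia.
Qed.

End Existence.

(** * Uniqueness *)

Section Before.
Variables (T : choiceType) (m : coxeter_matrix T).
Implicit Types (s t : T) (u v : seq T).

Fixpoint before s t v :=
  if v is q :: v' then (q == s) || (q != t) && before s t v' else false.

(** The order of the first [s] and the first [t] could change only by exchanging these two letters,
    which do not commute. *)
Lemma before_comm s t u v : s != t -> m s t != 2 -> comm_eq m u v ->
  before s t u = before s t v.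
Proof.
move=> st mst; move: u v; apply: comm_eq_inv => u p q v mpq pq.
elim: u => [|x u IH] /=; last by rewrite IH.
have [ps|ps] := eqVneq p s; have [qs|qs] := eqVneq q s;
  have [pt|pt] := eqVneq p t; have [qt|qt] := eqVneq q t => //=.
all: by move: pq st mst; rewrite -?ps -?qs -?pt -?qt ?eqxx ?mpq ?(cox_sym m q p) ?mpq.
Qed.

Lemma before_asym s t v : s != t -> before s t v -> ~~ before t s v.
Proof.
move=> st; elim: v => //= q v IH.
by have [->|qs] := eqVneq q s; [rewrite (negPf st) | have [] := eqVneq q t].
Qed.

Lemma before_cat s t u v : before s t (u ++ v) =
  if (s \in u) || (t \in u) then before s t u else before s t v.
Proof.
elim: u => //= q u IH; rewrite !in_cons IH (eq_sym s) (eq_sym t).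
by have [|] := eqVneq q s; have [] := eqVneq q t; rewrite //= orbT.
Qed.

End Before.

Section Uniqueness.
Variable n : nat.
Hypothesis n_gt0 : 0 < n.
Local Notation M := (affA n).
Local Notation sg := (sigma n).
Local Notation af := (aff n).
Implicit Types (s t : gen n) (u v w y : seq (gen n)) (i j k l r : nat).

Lemma comm_bword v : sparse v ->
  exists bs lg, [/\ all (is_block n) bs, path below (0, 0) lg, all (is_run n) lg
                  & comm_eq M v (bword bs (runs n lg))].
Proof.
have [k] := ubnP (size v); elim: k v => // k IH v vk spv.
have [av|av] := boolP (af \in v); last first.
  have [lg [plg alg c]] := comm_runs n_gt0 av spv.
  by exists [::], lg; split=> //; apply: comm_eq_sym.
have [u [y [au ev]]] : exists u y, af \notin u /\ v = u ++ af :: y.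
  elim: v av {vk spv} => //= s v IHv; rewrite in_cons.
  case: eqP => [<- _|/eqP sa /IHv[u [y [au ->]]]]; first by exists [::], v.
  by exists (s :: u), y; rewrite in_cons negb_or sa.
rewrite ev in spv vk *; have [b [z [bb c]]] := comm_block n_gt0 au spv.
have spz : sparse z.
  move: spv; rewrite (sparse_comm n_gt0 c) => /sparse_catr.
  by case/andP.
have [|bs [lg [abs plg alg c']]] := IH z _ spz.
  move: vk; rewrite (comm_eq_size c) size_cat /= addnS ltnS => vk.
  by apply: leq_ltn_trans vk; apply: leq_addl.
exists (b :: bs), lg; split=> //=; first by rewrite bb.
rewrite bword_cons; apply: comm_eq_trans c _; apply: comm_eq_catl.
exact: comm_eq_cons.
Qed.

Lemma sigma_inj i j : i <= n -> j <= n -> (sg i == sg j) = (i == j).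
Proof.
move=> le_in jn; apply/eqP/eqP => [/(congr1 val)|->//] /=.
by rewrite !inordK.
Qed.

Lemma before_comm_adj i j u v : i <= n -> j <= n -> edges n i j != 0 -> comm_eq M u v ->
  before (sg i) (sg j) u = before (sg i) (sg j) v.
Proof.
move=> le_in jn ne; apply: before_comm; last first.
  by rewrite affA_eq2 // !val_sigma // (negPf ne) andbF.
rewrite sigma_inj //; apply: contraNneq ne => ->; rewrite /edges; lia.
Qed.

Lemma sigma0 : sg 0 = af.
Proof. by apply: val_inj; rewrite /= val_sigma. Qed.

Lemma before_wfloor i j l v : i <= n -> j <= l.+1 -> l < i ->
  before (sg l.+1) (sg l) (wfloor n i j ++ v).
Proof.
elim: i => // i IH le_in jl li; rewrite wfloorS /=; last by lia.
by rewrite !sigma_inj; lia.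
Qed.

Lemma before_wceil r l v : 0 < r <= l -> l < n ->
  before (sg l) (sg l.+1) (wceil n r n ++ v).
Proof.
move=> rl ln; have [k] := ubnP (n.+1 - r); elim: k r rl => // k IH r rl rk.
rewrite wceil_cons /=; last by lia.
rewrite !sigma_inj; try lia; have [//|rl'] := eqVneq r l.
by rewrite (_ : (r == l.+1) = false) ?IH; lia.
Qed.

Lemma before_wceil_last r v : 0 < r <= n -> before (sg n) af (wceil n r n ++ v).
Proof.
move=> rn; have [k] := ubnP (n.+1 - r); elim: k r rn => // k IH r rn rk.
rewrite wceil_cons /=; last by lia.
rewrite -sigma0 !sigma_inj; try lia; have [//|rn'] := eqVneq r n.
by rewrite (_ : (r == 0) = false) ?sigma0 ?IH; lia.
Qed.

(* Each of i and r can be read off from the order in which the first occurrences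
   of consecutive letters appear. *)
Lemma comm_block_inj b c y z : is_block n b -> is_block n c ->
  comm_eq M (h n b.1 b.2 ++ af :: y) (h n c.1 c.2 ++ af :: z) ->
  b = c /\ comm_eq M y z.
Proof.
move=> bb bc cyz.
have mono1 b' c' u v : is_block n b' -> is_block n c' ->
    comm_eq M (h n b'.1 b'.2 ++ af :: u) (h n c'.1 c'.2 ++ af :: v) ->
    b'.1 <= c'.1.
  case: b' c' => [i r] [i' r'] /and3P[/= ir rn r1] /and3P[/= ir' rn' r1'] cuv.
  rewrite leqNgt; apply/negP => ii'.
  have /before_asym : before (sg i'.+1) (sg i') (h n i r ++ af :: u).
    by rewrite h_catE; apply: before_wfloor; lia.
  rewrite sigma_inj; try lia; move=> /(_ (negbT _)) /negP; apply; first by lia.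
  rewrite (before_comm_adj _ _ _ cuv); try lia; last by rewrite /edges; lia.
  (* For [i' = 0] the letter [sigma 0] is [a_{n+1}], and [sigma 1] does not precede it since
     [r' > 1]. *)
  rewrite h_catE; case: i' {ir' cuv ii'} (ii') => [|i'] ii'; last first.
    by rewrite wfloorS //= eqxx.
  rewrite wfloor_nil // cat0s before_cat sigma0 ifN /= ?eqxx //.
  by rewrite !mem_wceil ?val_sigma /=; lia.
have eq1 : b.1 = c.1.
  apply/eqP; rewrite eqn_leq (mono1 _ _ _ _ bb bc cyz).
  by rewrite (mono1 _ _ _ _ bc bb (comm_eq_sym cyz)).
have mono2 b' c' u v : b'.1 = c'.1 -> is_block n b' -> is_block n c' ->
    comm_eq M (h n b'.1 b'.2 ++ af :: u) (h n c'.1 c'.2 ++ af :: v) ->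
    c'.2 <= b'.2.
  case: b' c' => [i r] [_ r'] /= <- /and3P[/= ir rn r1] /and3P[/= ir' rn' r1'] cuv.
  rewrite leqNgt; apply/negP; case: r' rn' r1' ir' cuv => // l ln l1 il cuv rl.
  have iw s t : i < s -> t = af \/ i < t ->
      (s \in wfloor n i 1) || (t \in wfloor n i 1) = false.
    by move=> si [->|ti]; rewrite !mem_wfloor //=; lia.
  have [ln'|nl] := ltnP l n.
    have /before_asym : before (sg l) (sg l.+1) (h n i r ++ af :: u).
      rewrite h_catE before_cat iw ?val_sigma; try lia.
      by apply: before_wceil; lia.
    rewrite sigma_inj; try lia; move=> /(_ (negbT _)) /negP; apply; first by lia.
    rewrite (before_comm_adj _ _ _ cuv); try lia; last by rewrite /edges; lia.
    rewrite h_catE before_cat iw ?val_sigma; try lia.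
    by rewrite wceil_cons //= eqxx.
  (* For [r' = n + 1] the successor of [sigma n] in the cycle is [a_{n+1}], which replaces
     [sigma (l + 1)] in the comparison. *)
  have {nl ln l1} el : l = n by lia.
  rewrite {l}el in il cuv rl.
  have /before_asym : before (sg n) af (h n i r ++ af :: u).
    rewrite h_catE before_cat iw ?val_sigma //; try lia; last by left.
    by apply: before_wceil_last; lia.
  rewrite -{1}sigma0 sigma_inj; try lia; move=> /(_ (negbT _)) /negP; apply; first by lia.
  rewrite -{1}sigma0 (before_comm_adj _ _ _ cuv); try lia; last by rewrite /edges eqxx; lia.
  rewrite h_catE before_cat sigma0 orbC iw ?val_sigma //; try lia; last by left.
  by rewrite wceil_nil //= eqxx.
have eq2 : b.2 = c.2.
  apply/eqP; rewrite eqn_leq (mono2 _ _ _ _ eq1 bb bc cyz).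
  by rewrite (mono2 _ _ _ _ (esym eq1) bc bb (comm_eq_sym cyz)).
have ebc : b = c by case: b c eq1 eq2 {bb bc cyz} => [? ?] [? ?] /= -> ->.
split=> //; rewrite ebc in cyz.
by move/comm_eq_catI: cyz => /(@comm_eq_catI _ _ [:: af]).
Qed.

Lemma comm_bword_inj bs cs u v : all (is_block n) bs -> all (is_block n) cs ->
  af \notin u -> af \notin v ->
  comm_eq M (bword bs u) (bword cs v) -> bs = cs /\ comm_eq M u v.
Proof.
move=> + + au av; elim: bs cs => [|b bs IH] [|c cs] //=.
- move=> _ _ /comm_eq_perm/perm_mem/(_ af).
  by rewrite [bword [::] u]/= bword_cons [in RHS]mem_cat in_cons eqxx orbT (negPf au).
- move=> _ _ /comm_eq_perm/perm_mem/(_ af).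
  by rewrite bword_cons mem_cat in_cons eqxx orbT (negPf av).
move=> /andP[bb abs] /andP[bc acs]; rewrite !bword_cons.
by move=> /(comm_block_inj bb bc)[-> /(IH _ abs acs)[-> c']].
Qed.

Lemma mem_runs s p lg : path below p lg -> all (is_run n) lg ->
  s \in runs n lg -> p.2 < s.
Proof.
elim: lg p => [//|[k g] lg IH] p /= /andP[/andP[/= pk pg] plg].
move=> /andP[/and3P[/= g0 gk kn] alg]; rewrite runs_cons mem_cat mem_wfloor //=.
by case/orP=> [|/(IH _ plg alg) /=]; lia.
Qed.

Lemma aff_notin_runs p lg : path below p lg -> all (is_run n) lg ->
  af \notin runs n lg.
Proof. by move=> plg alg; apply/negP => /(mem_runs plg alg). Qed.

(** The bottom of the first run is the smallest letter of the word. Its top is determined by the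
    order of first occurrences: the word with top [a] starts with [a], whereas a larger top would
    put [a + 1] before [a]. *)
Lemma comm_runs_inj p q lg lg' :
  path below p lg -> path below q lg' -> all (is_run n) lg ->
  all (is_run n) lg' -> comm_eq M (runs n lg) (runs n lg') -> lg = lg'.
Proof.
elim: lg p q lg' => [|[k g] lg IH] p q [|[k' g'] lg'] //=.
- move=> _ _ _ /andP[/and3P[/= g0 gk kn] _] /comm_eq_size.
  by rewrite runs_cons /=; case: k' gk kn => [|k'] gk kn; [lia | rewrite wfloorS //; lia].
- move=> _ _ /andP[/and3P[/= g0 gk kn] _] _ /comm_eq_size.
  by rewrite runs_cons /=; case: k gk kn => [|k] gk kn; [lia | rewrite wfloorS //; lia].
move=> /andP[_ plg] /andP[_ plg'] /andP[rk alg] /andP[rk' alg'] c.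
have mono2 (a b : nat * nat) (l l' : seq (nat * nat)) : path below a l -> all (is_run n) (a :: l) ->
    path below b l' -> all (is_run n) (b :: l') ->
    perm_eq (runs n (a :: l)) (runs n (b :: l')) -> b.2 <= a.2.
  move=> /= pa /andP[/and3P[a0 aa an] _] pb /andP[/and3P[b0 bb bn] al'].
  move=> /perm_mem/(_ (sg a.2)); rewrite !runs_cons !mem_cat !mem_wfloor //.
  rewrite val_sigma ?leqnn ?aa; last by lia.
  by case/esym/orP => [/andP[]//|/(mem_runs pb al')]; rewrite val_sigma; lia.
have ar : all (is_run n) ((k, g) :: lg) by apply/andP.
have ar' : all (is_run n) ((k', g') :: lg') by apply/andP.
have eg : g = g'.
  apply/eqP; rewrite eqn_leq.
  have -> := mono2 _ _ _ _ plg' ar' plg ar (comm_eq_perm (comm_eq_sym c)).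
  exact: mono2 _ _ _ _ plg ar plg' ar' (comm_eq_perm c).
rewrite -{g' ar ar'}eg in rk' plg' c *.
have mono1 (a b : nat) (l l' : seq (nat * nat)) : is_run n (a, g) -> is_run n (b, g) ->
    comm_eq M (runs n ((a, g) :: l)) (runs n ((b, g) :: l')) -> b <= a.
  move=> /and3P[/= g0 ga an] /and3P[/= _ gb bn]; rewrite !runs_cons /= => cc.
  rewrite leqNgt; apply/negP => ab.
  have /before_asym : before (sg a.+1) (sg a) (wfloor n b g ++ runs n l').
    by apply: before_wfloor; lia.
  rewrite sigma_inj; try lia; move=> /(_ (negbT _)) /negP; apply; first by lia.
  rewrite -(before_comm_adj _ _ _ cc); try lia; last by rewrite /edges; lia.
  by case: a ga {an ab cc} => [|a] ga; [lia | rewrite wfloorS //= eqxx].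
have ek : k = k'.
  apply/eqP; rewrite eqn_leq (mono1 _ _ _ _ rk rk' c).
  by rewrite (mono1 _ _ _ _ rk' rk (comm_eq_sym c)).
rewrite -{}ek in rk' plg' c *; congr (_ :: _).
apply: IH plg plg' alg alg' _.
by move: c; rewrite !runs_cons => /comm_eq_catI.
Qed.

End Uniqueness.

(** * The conditions (a)-(d) *)

Section NormalForm.
Variable n : nat.
Hypothesis n_gt0 : 0 < n.
Local Notation M := (affA n).
Local Notation af := (aff n).
Implicit Types (b c : nat * nat) (bs irs lg : seq (nat * nat)).

Definition is_open b := b.1.+1 < b.2.

Definition nest irs := [seq b.1 | b <- irs] ++ rev [seq b.2 | b <- irs].

Arguments nest : simpl never.

Lemma nest_cons b irs : nest (b :: irs) = b.1 :: rcons (nest irs) b.2.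
Proof. by rewrite /nest /= rev_cons rcons_cat. Qed.

Lemma sorted_nest b c irs : sorted ltn (nest [:: b, c & irs]) =
  [&& b.1 < c.1, sorted ltn (nest (c :: irs)) & c.2 < b.2].
Proof.
rewrite (nest_cons b) (nest_cons c) /= rcons_path last_rcons.
by rewrite andbA.
Qed.

Lemma condAE b irs : condA n (b :: irs) <->
  [/\ sorted ltn (nest (b :: irs)),
      forall c, c \in b :: irs -> c.2 <= n.+1 &
      2 <= (last b irs).2 - (last b irs).1].
Proof. by []. Qed.

(** For open blocks [follows] means strict nesting, so the chain in (a) is a condition on
    consecutive pairs. The inequality [r_p - i_p >= 2] makes the last pair open, and nesting passes
    this on to the others. *)
Lemma condAP b irs :
  condA n (b :: irs) <->
  [/\ path follows b irs, all (is_block n) (b :: irs) & all is_open (b :: irs)].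
Proof.
elim: irs b => [|c irs IH] b; rewrite condAE.
  case: b => i r; rewrite /= !andbT /nest /= /is_block /is_open /=.
  split=> [[ir rn r2]|[_ bb bo]].
    by have /= rn1 := rn _ (mem_head _ _); split=> //; lia.
  split; try lia.
  by move=> d; rewrite inE => /eqP-> /=; lia.
rewrite sorted_nest; split.
  move=> [/and3P[b1 sc c2] bn l2].
  have /IH[pc bc oc] : condA n (c :: irs).
    by rewrite condAE; split=> // d dc; apply: bn; rewrite in_cons dc orbT.
  have bn' := bn b (mem_head _ _).
  have [bc1 oc1] : is_block n c /\ is_open c by case/andP: bc oc => + _ /andP[].
  split; apply/andP; split=> //.
  - by move: bc1 oc1; rewrite /is_block /is_open /follows /allowed; case: ifP; lia.
  - by move: bc1 oc1; rewrite /is_block /is_open; lia.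
  - by move: bc1 oc1; rewrite /is_block /is_open; lia.
move=> [/andP[fbc pc] /andP[bb bc] /andP[ob oc]].
have /IH : [/\ path follows c irs, all (is_block n) (c :: irs)
  & all is_open (c :: irs)] by [].
rewrite condAE => -[sc cn l2]; split=> //.
  rewrite sc; move: fbc bb ob; case/andP: bc oc => + _ /andP[+ _].
  by rewrite /is_block /is_open /follows /allowed; do ![case: ifP]; lia.
by move=> d; rewrite in_cons => /orP[/eqP->|/cn//]; case/and3P: bb.
Qed.

(** When the last block is open, the two alternatives of (b) together say [i_p < j < r_p]. *)
Lemma condBE irs j : all is_open irs -> irs <> [::] ->
  condB irs j <-> follows (last (0, 0) irs) (j, j.+1).
Proof.
case: irs => // b irs ob _; have ol : is_open (last b irs).
  by apply: (allP ob); apply: mem_last.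
rewrite /condB [last _ _]/=; case: (last b irs) ol => i r.
rewrite /is_open /follows /allowed /= eqxx orTb andbT.
by case: ifP => ?; split; lia.
Qed.

Lemma path_below p lg : path below p lg =
  path ltn p.1 [seq q.1 | q <- lg] && path ltn p.2 [seq q.2 | q <- lg].
Proof. by elim: lg p => //= q lg IH p; rewrite IH /below; lia. Qed.

Lemma size_runs p lg : path below p lg -> all (is_run n) lg ->
  p.1 <= n -> size lg <= n - p.1.
Proof.
elim: lg p => //= q lg IH p /andP[/andP[pq _] plg] /andP[/and3P[_ _ qn] alg] pn.
by have := IH _ plg alg qn; lia.
Qed.

(* The combined form of (c) and (d), b being the last block. *)
Definition tail_ok b lg :=
  if lg is (l, g) :: lg' then
    allowed b l &&
    path (gap (if b.2 == b.1.+1 then 0 else b.2)) l [seq q.1 | q <- lg']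
  else true.

Lemma condDP irs wr : all is_open irs -> irs <> [::] ->
  condD irs wr <-> exists lg, [/\ wr = runs n lg, path below (0, 0) lg,
    all (is_run n) lg & tail_ok (last (0, 0) irs) lg].
Proof.
case: irs => // b irs ob _; have ol : is_open (last b irs).
  by apply: (allP ob); apply: mem_last.
rewrite /condD [last _ _]/=; case: (last b irs) ol => i r ir.
have nr : (r == i.+1) = false by move: ir; rewrite /is_open /=; lia.
split.
  move=> [lg [[sz ->] [sl sg_] bd hd gp]]; exists lg.
  have {}bd (q : nat * nat) : q \in lg ->
    [/\ 1 <= q.1 <= n, 1 <= q.2 <= n & q.2 <= q.1] := bd q.
  split=> //.
  - rewrite path_below /= !path_min_sorted //.
    + by rewrite sl.
    + by apply/allP => x /mapP[q ql ->] /=; have [] := bd q ql; lia.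
    + by apply/allP => x /mapP[q ql ->] /=; have [] := bd q ql; lia.
  - by apply/allP => -[l g] /bd[/=]; rewrite /is_run /=; lia.
  case: lg {sz sl sg_ bd} hd gp => // -[l g] lg /= /(_ isT) hd gp.
  rewrite /tail_ok /allowed /= nr.
  rewrite hd; apply/(pathP 0) => k; rewrite size_map => klg.
  by apply/implyP => lt; have := gp k.+1; rewrite /= ltnS klg; apply.
move=> [lg [-> plg alg tl]]; exists lg.
have := size_runs plg alg (leq0n n); rewrite subn0 => sz.
split=> //.
- move: plg; rewrite path_below => /andP[p1 p2].
  by split; [case: {+}lg p1 => //= ? ? /andP[] | case: {+}lg p2 => //= ? ? /andP[]].
- by move=> -[l g] /(allP alg)/and3P[/= g0 gl ln]; split; lia.
- case: lg {plg alg sz} tl => // -[l g] lg /=.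
  by rewrite /allowed /= nr; case/andP.
case: lg {plg alg sz} tl => // [_ [|i'] //|[l g] lg /=].
rewrite nr => /andP[_ /(pathP 0) gp] [//|k] /= klg lt.
by have := gp k; rewrite size_map => /(_ klg)/implyP; apply.
Qed.

Lemma path_gap0 k (l : seq nat) : path ltn k l ->
  path (gap 0) k l = (l == iota k.+1 (size l)).
Proof.
elim: l k => //= x l IH k /andP[kx pl]; rewrite IH // eqseq_cons /gap ltn0 implybF.
rewrite -leqNgt; have [->|xk] := eqVneq x k.+1; first by rewrite leqnn.
by rewrite (_ : (x <= k.+1) = false) //; lia.
Qed.

Lemma runs_zip j d :
  runs n (zip (iota j (size d)) d) =
  flatten [seq wfloor n (j + e) (nth 0 d e) | e <- iota 0 (size d)].
Proof.
elim: d j => // x d IH j; rewrite /= runs_cons IH addn0 /=; congr (_ ++ flatten _).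
rewrite (iotaDl 1 0) -map_comp; apply: eq_map => e /=.
by rewrite add1n addSnnS.
Qed.

(** After the block [(j, j + 1)] the tops can only be [j], [j + 1] and so on, so just the bottoms
    [d] remain to be recorded. *)
Lemma condCP j wr : 1 <= j <= n ->
  condC j wr <-> exists lg, [/\ wr = runs n lg, path below (0, 0) lg,
    all (is_run n) lg & tail_ok (j, j.+1) lg].
Proof.
move=> jn; split.
  move=> [d [[dn jd] -> [sd bd] jc]]; exists (zip (iota j (size d)) d).
  have {}bd (x : nat) : x \in d -> 1 <= x <= n := bd x.
  have si : size (iota j (size d)) = size d by rewrite size_iota.
  rewrite runs_zip; split=> //.
  - rewrite path_below -!/(unzip1 _) -!/(unzip2 _) unzip1_zip ?unzip2_zip ?si //.
    rewrite !path_min_sorted ?sd ?iota_ltn_sorted //.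
      by apply/allP => x /bd /=; lia.
    by apply/allP => x; rewrite mem_iota /=; lia.
  - apply/(all_nthP (0, 0)) => e; rewrite size_zip si minnn => ed.
    rewrite nth_zip // nth_iota //.
    by have := jc e ed; have := bd _ (mem_nth 0 ed); rewrite /is_run /=; lia.
  case: d {bd dn jd jc} sd si => // x d /= sd [si]; rewrite /allowed /= !eqxx /=.
  rewrite -!/(unzip1 _) unzip1_zip ?si // path_gap0 ?size_iota //.
  by apply: (iota_ltn_sorted j (size d).+1).
move=> [lg [-> plg alg tl]]; exists (unzip2 lg); rewrite size_map.
have e1 : unzip1 lg = iota j (size lg).
  case: lg plg tl {alg} => // -[l g] lg /=; rewrite path_below /allowed /= !eqxx.
  move=> /andP[_ /andP[pl _]] /andP[/eqP el]; rewrite -{}el path_gap0 //.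
  by rewrite size_map => /eqP e; congr (_ :: _).
have eN e : e < size lg -> is_run n (j + e, nth 0 (unzip2 lg) e).
  move=> elg; have := allP alg _ (mem_nth (0, 0) elg).
  by rewrite (nth_map (0, 0)) // -(nth_iota 0 j elg) -e1 (nth_map (0, 0)).
have sz := size_runs plg alg (leq0n n); rewrite subn0 in sz.
split.
- split=> //; case: (size lg) eN => [|z] eN; first by lia.
  by have := eN z (ltnSn z); rewrite /is_run /=; lia.
- by rewrite -(size_map snd) -runs_zip size_map -e1 zip_unzip.
- move: plg; rewrite path_below => /andP[_ p2]; split.
    by case: {+}lg p2 => //= ? ? /andP[].
  by move=> x /mapP[[l g] /(allP alg)/and3P[/= g0 gl ln] ->] /=; lia.
by move=> e /eN; rewrite /is_run /=; lia.
Qed.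

Lemma tail_okP b lg : path below (0, 0) lg -> all (is_run n) lg ->
  tail_ok b lg <->
  forall l, 0 < l <= n -> ~~ allowed b l -> 0 < front l (runs n lg).
Proof.
case: lg => [//|[l g] lg] /= /andP[_ plg] alg.
by rewrite (front_runs_allowed n_gt0 b plg alg); split=> [/andP[]|[]] // -> ->.
Qed.

(* bs lists all the blocks of a normal form, including the repeated (j, j + 1),
   and lg the pairs (l_i, g_i) of its w_r. *)
Definition nf_data bs lg :=
  [/\ bs <> [::], all (is_block n) bs, sorted follows bs &
      [/\ path below (0, 0) lg, all (is_run n) lg & tail_ok (last (0, 0) bs) lg]].

Lemma follows_full j : follows (j, j.+1) (j, j.+1).
Proof. by rewrite /follows /allowed /= !eqxx. Qed.

Lemma path_nseq_full b j k : path follows b (nseq k.+1 (j, j.+1)) = follows b (j, j.+1).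
Proof.
rewrite /=; have -> : path follows (j, j.+1) (nseq k (j, j.+1)); last by rewrite andbT.
by elim: k => //= k ->; rewrite follows_full.
Qed.

Lemma sorted_cat_cons b irs bs : sorted follows ((b :: irs) ++ bs) =
  path follows b irs && path follows (last b irs) bs.
Proof. exact: cat_path. Qed.

Lemma last_nseq_full b j k : last b (nseq k.+1 (j, j.+1)) = (j, j.+1).
Proof. by rewrite /=; elim: k. Qed.

Lemma normal_formP irs k j wr :
  normal_form irs k j wr <->
  [/\ 1 <= j <= n, all is_open irs &
      exists2 lg, wr = runs n lg & nf_data (irs ++ nseq k (j, j.+1)) lg].
Proof.
have full_block : 1 <= j <= n -> is_block n (j, j.+1).
  by rewrite /is_block /=; lia.
split.
  case=> jn p0 cA cB cCD.
  have [oi [bi si]] : all is_open irs /\ all (is_block n) irs /\ sorted follows irs.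
    by case: irs cA {p0 cB cCD} => // b irs /(_ isT)/condAP[].
  split=> //; case: k p0 cB cCD => [|k] p0 cB /= cCD.
    have irs0 : irs <> [::] by move=> e; move: p0; rewrite e => /(_ erefl).
    have [lg [-> plg alg tl]] := (condDP wr oi irs0).1 cCD.
    by exists lg => //; rewrite cats0.
  have [lg [-> plg alg tl]] := (condCP wr jn).1 cCD.
  exists lg => //; split.
  - by case: irs {p0 cA cB oi bi si}.
  - by rewrite all_cat bi /= all_nseq full_block ?orbT.
  - case: irs cB oi si {p0 cA bi} => [_ _ _|b irs cB oi si].
      case: k => // k.
      rewrite -[sorted _ _]/(path follows (j, j.+1) (nseq k.+1 (j, j.+1))).
      by rewrite path_nseq_full follows_full.
    rewrite sorted_cat_cons path_nseq_full; apply/andP; split=> //.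
    by apply/(condBE j oi) => //; apply: cB.
  by split=> //; rewrite last_cat last_nseq_full.
move=> [jn oi [lg -> [bs0 abs sbs [plg alg tl]]]].
have [bi si] : all (is_block n) irs /\ sorted follows irs.
  move: abs; rewrite all_cat => /andP[-> _]; split=> //.
  by case: irs sbs {oi bs0 tl} => //= b irs; rewrite cat_path => /andP[].
split=> //.
- by move=> /size0nil e; case: k bs0 {sbs tl abs} => //; rewrite e.
- by case: irs oi bi si {bs0 abs sbs tl} => // b irs oi bi si _; apply/condAP.
- case: irs oi sbs {bs0 abs bi si tl} => // b irs oi.
  rewrite sorted_cat_cons; case: k => // k /andP[_]; rewrite path_nseq_full => f _ _.
  by apply/(condBE j oi).
case: k bs0 abs sbs tl => [|k] bs0 abs sbs tl /=.
  rewrite cats0 in bs0 tl.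
  by apply/(condDP _ oi bs0); exists lg.
by apply/(condCP _ jn); exists lg; split=> //; move: tl; rewrite last_cat last_nseq_full.
Qed.

(** A block [(i, i + 1)] can be followed only by itself, so all open blocks come first. *)
Lemma nf_data_split bs lg : nf_data bs lg ->
  exists irs k j, [/\ 1 <= j <= n, all is_open irs & bs = irs ++ nseq k (j, j.+1)].
Proof.
(* For [k = 0] any [j] in range would do. *)
move=> [_ + + _]; elim: bs => [|b bs IH]; first by exists [::], 0, 1; split.
move=> /= /andP[bb abs] pb.
have [irs [k [j [jn oi ebs]]]] := IH abs (path_sorted pb).
have [ob|cb] := boolP (is_open b).
  by exists (b :: irs), k, j; rewrite /= ob ebs.
case: b bb cb pb => i r bb cb; have er : r = i.+1.
  by move: bb cb; rewrite /is_block /is_open /=; lia.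
rewrite {r cb}er in bb *; move=> pb.
have i1n : 1 <= i <= n by move: bb; rewrite /is_block /=; lia.
case: irs oi ebs => [|c irs] oi ebs.
  case: k ebs => [|k] ebs; first by exists [::], 1, i; rewrite ebs.
  exists [::], k.+2, j; split=> //; rewrite ebs /=; congr (_ :: _).
  move: pb; rewrite ebs /= => /andP[+ _]; rewrite /follows /allowed /= !eqxx.
  by rewrite andbT => /eqP->.
move: pb; rewrite ebs /= => /andP[+ _]; case/andP: oi => oc _.
move: abs; rewrite ebs /= => /andP[bc _].
rewrite /follows /allowed /= eqxx; move: oc bc.
by rewrite /is_open /is_block; lia.
Qed.

Lemma cat_nseq_inj irs irs' k k' j j' :
  all is_open irs -> all is_open irs' ->
  irs ++ nseq k (j, j.+1) = irs' ++ nseq k' (j', j'.+1) ->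
  [/\ irs = irs', k = k' & 0 < k -> j = j'].
Proof.
elim: irs irs' => [|b irs IH] [|c irs'] /=.
- move=> _ _ e; have ek : k = k' by move/(congr1 size): e; rewrite !size_nseq.
  by split=> //; case: k k' e ek => // k [] // k' [].
- by move=> _ /andP[oc _]; case: k => // k [e _]; move: oc; rewrite -e /is_open ltnn.
- by move=> /andP[ob _] _; case: k' {IH} => // k' [e _]; move: ob; rewrite e /is_open ltnn.
by move=> /andP[_ oi] /andP[_ oi'] [-> /(IH _ oi oi')[-> -> h]].
Qed.

Lemma nf_data_sparse bs lg : nf_data bs lg -> sparse (bword bs (runs n lg)).
Proof.
case: bs => [[]//|b bs] [_ abs sbs [plg alg tl]].
apply/(sparse_bword n_gt0 abs); first exact: aff_notin_runs plg alg.
by split=> //; [apply: sparse_runs plg alg | apply/tail_okP].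
Qed.

Lemma sparse_nf_data bs lg : bs <> [::] -> all (is_block n) bs ->
  path below (0, 0) lg -> all (is_run n) lg ->
  sparse (bword bs (runs n lg)) -> nf_data bs lg.
Proof.
case: bs => // b bs _ abs plg alg /(sparse_bword n_gt0 abs)[].
  exact: aff_notin_runs plg alg.
by move=> _ pb tl; split=> //; split=> //; apply/tail_okP.
Qed.

(** Strict nesting lowers [r - i] by at least 2 at each step, and the innermost difference is at
    least 2. This bounds [p]. *)
Lemma size_open b irs : path follows b irs -> all is_open (b :: irs) ->
  b.1 + (size irs).+1.*2 <= b.2.
Proof.
elim: irs b => [|c irs IH] b /= => [_ /andP[ob _]|].
  by move: ob; rewrite /is_open; lia.
move=> /andP[fbc pc] /andP[ob oc]; have := IH c pc oc.
case/andP: oc => oc _; move: fbc ob oc; rewrite /follows /allowed /is_open.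
by do ![case: ifP]; lia.
Qed.

Lemma nf_data_size irs k j lg : nf_data (irs ++ nseq k (j, j.+1)) lg ->
  all is_open irs -> size irs <= n.+1 %/ 2.
Proof.
case: irs => // b irs [_ + + _] oi; rewrite sorted_cat_cons.
move=> /= /andP[/and3P[_ bn _] _] /andP[pb _].
by rewrite leq_divRL //; have := size_open pb oi; rewrite /=; lia.
Qed.

(** Prefixing [u] to a reduced expression of the suffix gives a reduced expression of the whole
    element; the resulting commutations descend by cancelling [u]. *)
Lemma WcA_suffix u v : all (@is_sigma n) v -> reduced_word M (u ++ v) ->
  fully_commutative (cprod M (u ++ v)) -> WcA (cprod M v).
Proof.
move=> sv ruv /fully_commutativeE fc; split; first by exists v.
have h x : reduced_in (@is_sigma n) (cprod M v) x ->
    reduced_expr (cprod M (u ++ v)) (u ++ x).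
  move=> [[_ ex] xmin]; have e : cprod M (u ++ x) = cprod M (u ++ v).
    by rewrite !(cprod_cat _ u) ex.
  apply/reduced_exprE; split=> // v' ev'.
  have [_ /(_ v' ev')] := (reduced_exprE _ _).1 ruv.
  by apply: leq_trans; rewrite !size_cat leq_add2l; apply: xmin.
by move=> x x' /h rx /h rx'; apply: (@comm_eq_catI _ _ u); apply: fc.
Qed.

End NormalForm.

Theorem theorem2p11 (n : nat) (hn : 1 <= n) :
  (forall w : coxeter_group (affA n),
     fully_commutative w -> 1 <= affine_length w ->
     exists (irs : seq (nat * nat)) (k j : nat) (wr : seq (gen n)),
       [/\ normal_form irs k j wr,
           reduced_expr w (nf_word irs k j wr),
           WcA (cprod (affA n) wr),
           size irs <= n.+1 %/ 2 &
           forall (irs' : seq (nat * nat)) (k' j' : nat) (wr' : seq (gen n)),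
             normal_form irs' k' j' wr' ->
             reduced_expr w (nf_word irs' k' j' wr') ->
             WcA (cprod (affA n) wr') ->
             [/\ irs' = irs, k' = k, 0 < k -> j' = j & wr' = wr]])
  /\
  (forall (irs : seq (nat * nat)) (k j : nat) (wr : seq (gen n)),
     normal_form irs k j wr ->
     reduced_word (affA n) (nf_word irs k j wr) /\
     fully_commutative (cprod (affA n) (nf_word irs k j wr))).
Proof.
split; last first.
  move=> irs k j wr /(normal_formP hn)[jn oi [lg -> nf]].
  by rewrite nf_wordE; apply/(sparseP hn); apply: nf_data_sparse nf.
move=> w fcw Lw; have [v rv] := reduced_expr_exists w.
move: Lw; rewrite /affine_length (occurrencesE (aff n) fcw rv) => av.
have [ev _] := (reduced_exprE _ _).1 rv.
have rwv : reduced_word (affA n) v by rewrite /reduced_word ev.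
have spv : sparse v by apply/(sparseP hn); rewrite ev.
have [bs [lg [abs plg alg c]]] := comm_bword hn spv.
(* Without a block there would be no [a_{n+1}], against the affine length. *)
have bs0 : bs <> [::].
  move=> e; move: av; rewrite (seq.permP (comm_eq_perm c)) e lt0n.
  by rewrite -leqn0 -ltnNge -has_count has_pred1 (negPf (aff_notin_runs hn plg alg)).
have nf : nf_data n bs lg.
  by apply: sparse_nf_data; rewrite // -(sparse_comm hn c).
have [irs [k [j [jn oi ebs]]]] := nf_data_split hn nf.
have rnf : reduced_expr w (nf_word irs k j (runs n lg)).
  rewrite nf_wordE -ebs -ev (comm_eq_cprod c).
  exact: reduced_word_eq (comm_eq_cprod c) (comm_eq_size c) rwv.
exists irs, k, j, (runs n lg); split=> //.
- by apply/(normal_formP hn); split=> //; exists lg; rewrite -?ebs.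
- have e : cprod (affA n) (bword bs (runs n lg)) = w by rewrite -(comm_eq_cprod c).
  apply: (@WcA_suffix n (flatten [seq h n b.1 b.2 ++ [:: aff n] | b <- bs])).
  + by apply/allP => s sr; apply: contraNneq (aff_notin_runs hn plg alg) => <-.
  + by move: rnf; rewrite nf_wordE -ebs /reduced_word -/(bword _ _) e.
  by rewrite -/(bword _ _) e.
- by move: nf; rewrite ebs => /nf_data_size; apply.
move=> irs' k' j' wr' /(normal_formP hn)[jn' oi' [lg' -> nf']] rnf' _.
(* Both normal forms are reduced expressions of a fully commutative element, hence differ by
   commutations only; cancelling blocks and then runs recovers the parameters. *)
have cc : comm_eq (affA n) (bword bs (runs n lg))
    (bword (irs' ++ nseq k' (j', j'.+1)) (runs n lg')).
  by rewrite ebs -!nf_wordE; apply: (fully_commutativeE _).1 fcw _ _ rnf rnf'.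
have [_ abs' _ [plg' alg' _]] := nf'.
have [e cr] := comm_bword_inj hn abs abs' (aff_notin_runs hn plg alg)
  (aff_notin_runs hn plg' alg') cc.
rewrite (comm_runs_inj hn plg plg' alg alg' cr).
have [-> -> ej] := cat_nseq_inj oi oi' (etrans (esym ebs) e).
by split=> // k0; rewrite ej.
Qed.
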